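(* The sequence $\bigl(Z_n^o(x,f,g,h,\alpha,\beta\,|\,p,q)\bigr)_{n\ge0}$ is coefficientwise-Hankel totally positive in the variables $\{x,f,g,h,\alpha,\beta,p,q\}$.
   Context: $\mathfrak{S}_N$ is the set of permutations $\sigma=\sigma_1\cdots\sigma_N$ of $[N]$. With the convention $\sigma_0=\sigma_{N+1}=0$, a letter $\sigma_i$ ($i\in[N]$) is a valley if $\sigma_{i-1}>\sigma_i<\sigma_{i+1}$ and a peak if $\sigma_{i-1}<\sigma_i>\sigma_{i+1}$; $\mathrm{Val}(\sigma)$, $\mathrm{Pk}(\sigma)$ are the sets of letters that are valleys, peaks. $\mathrm{des}(\sigma)=\#\{1\le i\le N-1:\sigma_i>\sigma_{i+1}\}$. A letter is a left-to-right (resp. right-to-left) maximum if it is larger than all letters to its left (resp. right); $\mathrm{lmax},\mathrm{rmax}$ count these, and $\mathrm{lmaxpk}$ (resp. $\mathrm{rmaxpk}$) counts left-to-right (resp. right-to-left) maxima that are peaks. For $\sigma\in\mathfrak{S}_N$, $\mathrm{D}(\sigma)=\sum_{i\in\mathrm{Pk}(\sigma)\setminus\{N\}}i-\sum_{j\in\mathrm{Val}(\sigma)}j$. $(31\!-\!2)(\sigma)$ is the number of pairs $i<j\le N$ with $\sigma_i>\sigma_j>\sigma_{i+1}$; $(2\!-\!13)(\sigma)$ is the number of pairs $i<j<N$ with $\sigma_j<\sigma_i<\sigma_{j+1}$. $\mathcal{Z}_N$ is the set of alternating permutations of $[N]$: those with $\sigma_1>\sigma_2<\sigma_3>\sigma_4<\cdots$.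 Define $$Z_n^o(x,f,g,h,\alpha,\beta\,|\,p,q)=\sum_{\sigma\in\mathcal{Z}_{2n+1}}x^{\mathrm{des}(\sigma)}f^{\mathrm{lmaxpk}(\sigma)-1}g^{\mathrm{rmaxpk}(\sigma)-1}h^{\mathrm{D}(\sigma)}\alpha^{\mathrm{lmax}(\sigma)-1}\beta^{\mathrm{rmax}(\sigma)-1}p^{(31-2)(\sigma)}q^{(2-13)(\sigma)}.$$ A sequence $(a_n)_{n\ge0}$ of real polynomials in a set of variables $\mathbf{X}$ is coefficientwise-Hankel totally positive in $\mathbf{X}$ if every minor of the infinite Hankel matrix $(a_{i+j})_{i,j\ge0}$ is a polynomial in $\mathbf{X}$ with nonnegative coefficients. *)

(* Defs.v *)
From HB Require Import structures.
From mathcomp Require Import all_boot all_order all_fingroup all_algebra zify.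
From mathcomp Require Import reals mpoly.

Set Implicit Arguments.
Unset Strict Implicit.
Unset Printing Implicit Defensive.

Import Order.TTheory GRing.Theory Num.Theory.
Local Open Scope ring_scope.

Section PermutationStatistics.
Local Open Scope nat_scope.
Variables (N : nat) (s : 'S_N).

(* ['S_N] acts on [{0, ..., N-1}]; positions and letters below are shifted so
   that both range over [{1, ..., N}], and [letter i] is 0 for every other [i],
   in particular for [i = 0] and [i = N + 1]. *)
Definition letter (i : nat) : nat :=
  if i is k.+1 then (if insub k is Some o then (s o).+1 else 0) else 0.

Definition positions : seq nat := iota 1 N.

Definition valley_at (i : nat) : bool :=
  (letter i.-1 > letter i) && (letter i < letter i.+1).
Definition peak_at (i : nat) : bool :=
  (letter i.-1 < letter i) && (letter i > letter i.+1).

Definition Val : seq nat := [seq letter i | i <- positions & valley_at i].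
Definition Pk : seq nat := [seq letter i | i <- positions & peak_at i].

Definition des : nat := count (fun i => letter i > letter i.+1) (iota 1 N.-1).

Definition lmax_at (i : nat) : bool :=
  all (fun j => (j < i) ==> (letter j < letter i)) positions.
Definition rmax_at (i : nat) : bool :=
  all (fun j => (i < j) ==> (letter j < letter i)) positions.

Definition lmax : nat := count lmax_at positions.
Definition rmax : nat := count rmax_at positions.
Definition lmaxpk : nat := count (fun i => lmax_at i && peak_at i) positions.
Definition rmaxpk : nat := count (fun i => rmax_at i && peak_at i) positions.

Definition Dstat : int :=
  ((\sum_(v <- Pk | v != N) v)%N%:Z - (\sum_(v <- Val) v)%N%:Z)%R.

Definition pat31_2 : nat :=
  count (fun ij => [&& ij.1 < ij.2, letter ij.1 > letter ij.2
                     & letter ij.2 > letter ij.1.+1])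
        [seq (i, j) | i <- positions, j <- positions].
Definition pat2_13 : nat :=
  count (fun ij => [&& ij.1 < ij.2, ij.2 < N, letter ij.2 < letter ij.1
                     & letter ij.1 < letter ij.2.+1])
        [seq (i, j) | i <- positions, j <- positions].

Definition alternating : bool :=
  all (fun i => if odd i then letter i > letter i.+1
                else letter i < letter i.+1) (iota 1 N.-1).

End PermutationStatistics.

Arguments letter : simpl never.

Section ExponentsNonnegative.
Local Open Scope nat_scope.
Variables (N : nat) (s : 'S_N).

Let letterE i (lt_iN : i < N) : letter s i.+1 = (s (Ordinal lt_iN)).+1.
Proof. by rewrite /letter insubT. Qed.

Let letter_out i : N <= i -> letter s i.+1 = 0.
Proof. by move=> le_Ni; rewrite /letter insubF // ltnNge le_Ni. Qed.

Lemma letter_max : 0 < N -> exists2 i, 0 < i <= N & letter s i = N /\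
  forall j, j != i -> letter s j < N.
Proof.
move=> N_gt0; have ltN1 : N.-1 < N by rewrite ltn_predL.
pose o := (s^-1)%g (Ordinal ltN1).
have so : s o = Ordinal ltN1 by rewrite /o permKV.
exists o.+1; first by rewrite ltn_ord.
split=> [|[|j] // neq].
  rewrite letterE (_ : Ordinal _ = o); last exact: val_inj.
  by rewrite so /= prednK.
case: (ltnP j N) => [lt_jN|/letter_out-> //].
rewrite letterE ltn_neqAle ltn_ord andbT.
apply: contraNneq neq => e.
have e' : s (Ordinal lt_jN) = s o.
  by rewrite so; apply: val_inj; move/(congr1 predn): e.
by rewrite -(perm_inj e').
Qed.

Lemma lmaxpk_gt0 : 0 < N -> 0 < lmaxpk s.
Proof.
move=> /letter_max [i /andP[i0 iN] [li lj]].
rewrite -has_count; apply/hasP; exists i; first by rewrite mem_iota; lia.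
rewrite /lmax_at /peak_at li !lj ?andbT; try by apply/eqP; lia.
by apply/allP => j _; apply/implyP => ji; apply: lj; rewrite ltn_eqF.
Qed.

Lemma rmaxpk_gt0 : 0 < N -> 0 < rmaxpk s.
Proof.
move=> /letter_max [i /andP[i0 iN] [li lj]].
rewrite -has_count; apply/hasP; exists i; first by rewrite mem_iota; lia.
rewrite /rmax_at /peak_at li !lj ?andbT; try by apply/eqP; lia.
by apply/allP => j _; apply/implyP => ji; apply: lj; rewrite gtn_eqF.
Qed.

Lemma lmax_gt0 : 0 < N -> 0 < lmax s.
Proof.
move=> /lmaxpk_gt0 /leq_trans; apply.
by apply: sub_count => i /andP[].
Qed.

Lemma rmax_gt0 : 0 < N -> 0 < rmax s.
Proof.
move=> /rmaxpk_gt0 /leq_trans; apply.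
by apply: sub_count => i /andP[].
Qed.

End ExponentsNonnegative.

Lemma Dstat_ge0 (N : nat) (s : 'S_N) : odd N -> alternating s -> 0 <= Dstat s.
Proof.
move=> oddN /allP alt; rewrite /Dstat subr_ge0 lez_nat.
have [n NE] : exists n, N = (2 * n).+1 by exists N./2; lia.
pose l := letter s.
have l0 : l 0%N = 0%N by [].
have lN : l N.+1 = 0%N by rewrite /l /letter insubF ?ltnn.
have lpos i : (0 < i <= N)%N -> (0 < l i)%N.
  by case: i => // i /= lt_i; rewrite /l /letter insubT.
have altl i : (0 < i < N)%N ->
    if odd i then (l i.+1 < l i)%N else (l i < l i.+1)%N.
  by move=> hi; apply: alt; rewrite mem_iota /=; lia.
have pkE i : (0 < i <= N)%N -> peak_at s i = odd i.
  move=> hi; rewrite /peak_at -/l.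
  have h1 := altl i; have h2 := altl i.-1; have h3 := lpos i hi.
  case: (eqVneq i 1%N) h1 h2 => [->|ni1] h1 h2; last first.
    have hi1 : (0 < i.-1 < N)%N by lia.
    move: (h2 hi1); rewrite (_ : i.-1.+1 = i); last by lia.
    have -> : odd i.-1 = ~~ odd i by lia.
    case: (boolP (odd i)) => /= [oi ->|oi lt1]; last by rewrite ltnNge ltnW.
    case: (eqVneq i N) => [->|niN]; first by rewrite lN; apply: lpos; lia.
    by move: (h1 ltac:(lia)); rewrite oi.
  rewrite l0 (lpos 1%N) /=; last by lia.
  case: (eqVneq N 1%N) => [N1|nN]; last by (apply: h1; lia).
  by move: lN; rewrite N1 => ->; apply: lpos; rewrite N1.
have valE i : (0 < i <= N)%N -> valley_at s i = ~~ odd i.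
  move=> hi; case: (boolP (odd i)) => oi /=.
    have := pkE i hi; rewrite oi /valley_at /peak_at => /andP[/ltnW].
    by rewrite leqNgt => /negbTE ->.
  have h1 := altl i ltac:(lia).
  have h2 := altl i.-1 ltac:(lia).
  rewrite /valley_at -/l.
  move: h1 h2; rewrite (negbTE oi) => ->.
  rewrite (_ : i.-1.+1 = i); last by lia.
  by rewrite (_ : odd i.-1) ?andbT //; lia.
have key m k : (m <= n)%N -> (k <= m)%N ->
  (\sum_(j < m) l (2 * j).+2 + l (2 * k).+1 <= \sum_(j < m.+1) l (2 * j).+1)%N.
  elim: m k => [|m IH] k mn km.
    by rewrite big_ord0 big_ord_recr big_ord0 /= (_ : k = 0%N) //; lia.
  rewrite [X in (_ <= X)%N]big_ord_recr [X in (X + _ <= _)%N]big_ord_recr /=.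
  have d : (l (2 * m).+2 < l (2 * m).+1)%N.
    by have := altl (2 * m).+1 ltac:(lia); rewrite (_ : odd _) //; lia.
  have u : (l (2 * m).+2 < l (2 * m.+1).+1)%N.
    have e2 : odd (2 * m).+2 = false by lia.
    have e3 : (2 * m.+1).+1 = (2 * m).+3 by lia.
    by have := altl (2 * m).+2 ltac:(lia); rewrite e2 e3.
  case: (leqP k m) => hk.
    by rewrite addnAC; exact: leq_add (IH k (ltnW mn) hk) (ltnW u).
  have -> : k = m.+1 by lia.
  rewrite leq_add2r (leq_trans _ (IH m (ltnW mn) (leqnn m))) //.
  by rewrite leq_add2l ltnW.
have split_iota (F : nat -> nat) b m :
    (\sum_(i <- iota 1 (2 * m).+1 | odd i (+) b) F i =
     if b then \sum_(j < m) F (2 * j).+2 else \sum_(j < m.+1) F (2 * j).+1)%N.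
  elim: m => [|m IH].
    case: b; rewrite /= big_cons big_nil /= ?big_ord0 //.
    by rewrite big_ord_recr big_ord0 /= addn0.
  rewrite (_ : (2 * m.+1).+1 = (2 * m).+1 + 2)%N; last by lia.
  rewrite iotaD big_cat /= IH 2!big_cons big_nil /=.
  have -> : odd (2 * m) = false by lia.
  by case: b {IH} => /=; rewrite [in RHS]big_ord_recr /= ?addn0 //;
    congr (_ + F _)%N; lia.
rewrite /Pk /Val !big_map !big_filter_cond.
have -> : (\sum_(i <- positions N | valley_at s i && true) letter s i =
           \sum_(i <- positions N | odd i (+) true) l i)%N.
  rewrite big_seq_cond [RHS]big_seq_cond; apply: eq_bigl => i.
  rewrite mem_iota andbT; case: (boolP (_ <= i < _)%N) => //= hi.
  by rewrite valE ?addbT //; lia.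
have -> : (\sum_(i <- positions N | peak_at s i && (letter s i != N))
              letter s i =
           \sum_(i <- positions N | odd i && (l i != N)) l i)%N.
  rewrite big_seq_cond [RHS]big_seq_cond; apply: eq_bigl => i.
  rewrite mem_iota; case: (boolP (_ <= i < _)%N) => //= hi.
  by rewrite pkE //; lia.
have [io hio [lo ub]] := letter_max s ltac:(lia).
rewrite -/l in lo ub hio.
have oo : odd io by rewrite -(pkE _ hio) /peak_at -/l lo !ub //; lia.
have posE : positions N = iota 1 (2 * n).+1 by rewrite /positions NE.
rewrite posE split_iota.
have := key n (io./2) (leqnn n) ltac:(lia).
rewrite (_ : (2 * io./2).+1 = io) ?lo; last by lia.
have /= <- := split_iota l false n.
rewrite (eq_bigl odd); last by move=> i; rewrite addbF.
have io_in : io \in iota 1 (2 * n).+1 by rewrite mem_iota; lia.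
rewrite [X in (_ <= X)%N -> _]big_mkcond (bigD1_seq io io_in (iota_uniq _ _)).
rewrite oo lo -big_mkcondr [X in (X <= _)%N -> _]addnC leq_add2l.
move=> /leq_trans; apply.
rewrite leq_eqVlt; apply/orP; left; apply/eqP.
apply: eq_bigl => i; rewrite andbC; congr (_ && _).
by case: (eqVneq i io) => [->|ni]; [rewrite lo eqxx | rewrite ltn_eqF ?ub].
Qed.

(* The truncated subtractions and the absolute value in the exponents are
   harmless: see [lmaxpk_gt0], [rmaxpk_gt0], [lmax_gt0], [rmax_gt0] and
   [Dstat_ge0]. *)
Definition Zo (A : comNzRingType) (x f g h alpha beta p q : A) (n : nat) : A :=
  \sum_(s : 'S_(2 * n).+1 | alternating s)
    x ^+ des s * f ^+ (lmaxpk s).-1 * g ^+ (rmaxpk s).-1 * h ^+ `|Dstat s|%N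
    * alpha ^+ (lmax s).-1 * beta ^+ (rmax s).-1
    * p ^+ pat31_2 s * q ^+ pat2_13 s.

Definition coef_nonneg (R : realType) (m : nat) (P : {mpoly R[m]}) : Prop :=
  forall mon : 'X_{1..m}, 0 <= P@_mon.

(* A minor of an infinite matrix is given by strictly increasing finite lists
   [r], [c] of row and column indices of the same length. *)
Definition coefficientwise_Hankel_TP (R : realType) (m : nat)
    (a : nat -> {mpoly R[m]}) : Prop :=
  forall (k : nat) (r c : 'I_k -> nat),
    {homo r : i j / (i < j)%N} -> {homo c : i j / (i < j)%N} ->
    coef_nonneg (\det (\matrix_(i < k, j < k) a (r i + c j)%N)).

Definition Zo_poly (R : realType) (n : nat) : {mpoly R[8]} :=
  let X (k : nat) : {mpoly R[8]} := 'X_(inord k) in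
  Zo (X 0%N) (X 1%N) (X 2%N) (X 3%N) (X 4%N) (X 5%N) (X 6%N) (X 7%N) n.

(* Main.v *)
Require Import Defs.
From mathcomp Require Import all_boot all_order all_fingroup all_algebra.
From mathcomp Require Import reals mpoly zify ring.

Set Implicit Arguments.
Unset Strict Implicit.
Unset Printing Implicit Defensive.

Import Order.TTheory GRing.Theory Num.Theory.
Local Open Scope ring_scope.

(** Both halves of the argument are about walks on the nonnegative integers whose
    steps carry weights with nonnegative coefficients.

    From permutations to walks.  Let [N = 2n+1], write an alternating
    permutation with a zero at each end, and build it by inserting its letters in
    decreasing order.  When the letters above [v] are present, each maximal run
    of smaller letters still to come is recorded by a single zero, the zeros at
    the two ends being counted among these smaller letters.  A letter
    [v] that is a peak turns a zero into [0 v 0]; a letter that is a valley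
    turns a zero other than the first and the last into [v].  So the
    number of zeros goes up or down by one at each step, and the permutations
    become walks with labelled steps (the bijection of Francon and Viennot).
    The statistics can be read off the labels.  If [a] zeros lie to
    the left and [b] zeros to the right of the chosen one, then the descents
    from a letter above [v] to a letter below [v] on the left of [v] correspond
    to [a] zeros for a peak, and to [a - 1] for a valley; the same holds for
    ascents on the right.  So a peak contributes [p ^ a * q ^ b] and a valley
    [p ^ (a - 1) * q ^ (b - 1)].  The new letter is a left-to-right maximum
    exactly when it is a peak with [a = 0], and symmetrically on the right; in
    particular such maxima are always peaks here.  Finally [D] is the sum of the
    two pattern counts, because both are the area under the walk
    ([altsum_words], [Dstat_altsum]).  Hence the sum over alternating
    permutations is the sum of the weights of the walks of length [2n] from 0 to
    0 ([sum_words], [Zo_walk]).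

    From walks to minors.  The entry [(i, j)] of the Hankel matrix counts walks
    from height 0 at time [-2i] to height 0 at time [2j], that is, paths in a
    planar network.  Cut the network at a time [t] and let the columns stand for
    the vertices met by the cut, together with the sources not yet started or
    the sinks already reached.  Moving the cut by one time step replaces each
    column by a combination of two neighbouring columns with nonnegative
    coefficients, and columns further to the right use columns further to the
    right.  Expanding a minor by multilinearity in its columns gives minors of
    the previous matrix, or determinants with two equal columns
    ([col_TP_planar_step]); so nonnegativity is carried from the identity matrix
    through all the cuts to the Hankel matrix ([walk_Hankel_TP]). *)

(** * Weighted walks *)
Section WeightedWalks.
Variable A : comNzRingType.
Variables u d : nat -> A.

(** The sum of the weights of the walks of length [n] from height 0 to height [h],
    where a step from [h] to [h + 1] has weight [u h] and a step from [h] to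
    [h - 1] has weight [d h]. *)
Fixpoint walk (n h : nat) : A :=
  if n is n'.+1 then
    (if h is h'.+1 then u h' * walk n' h' else 0) + d h.+1 * walk n' h.+1
  else (h == 0%N)%:R.

Lemma walkS0 n : walk n.+1 0 = d 1 * walk n 1.
Proof. by rewrite /= add0r. Qed.

Lemma walkSS n h :
  walk n.+1 h.+1 = u h * walk n h + d h.+2 * walk n h.+2.
Proof. by []. Qed.

End WeightedWalks.

(** * Minors under planar column operations *)
Lemma det_col_pair (A : comNzRingType) k (F G : 'I_k -> 'I_k -> A) :
  \det (\matrix_(i, j) (F i j + G i j)) =
  \sum_(e : {ffun 'I_k -> bool}) \det (\matrix_(i, j) (if e j then F i j else G i j)).
Proof.
rewrite -det_tr /determinant.
transitivity (\sum_(s : 'S_k) \sum_(e : {ffun 'I_k -> bool})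
   (-1) ^+ s * \prod_j (if e j then F (s j) j else G (s j) j)).
  apply: eq_bigr => s _; rewrite -mulr_sumr; congr (_ * _).
  rewrite -(bigA_distr_bigA (fun j (b : bool) => if b then F (s j) j else G (s j) j)).
  apply: eq_bigr => j _; rewrite !mxE (bigD1 true) //= (big_pred1 false) //.
  by case.
rewrite exchange_big /=; apply: eq_bigr => e _; rewrite -[RHS]det_tr.
apply: eq_bigr => s _; congr (_ * _); apply: eq_bigr => j _.
by rewrite !mxE.
Qed.

Lemma det_col_scale (A : comNzRingType) k (b : 'I_k -> A) (F : 'I_k -> 'I_k -> A) :
  \det (\matrix_(i, j) (b j * F i j)) = (\prod_j b j) * \det (\matrix_(i, j) F i j).
Proof.
rewrite (_ : (\matrix_(i, j) (b j * F i j)) =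
   (\matrix_(i, j) F i j) *m diag_mx (\row_j b j)).
  rewrite det_mulmx det_diag mulrC; congr (_ * _).
  by apply: eq_bigr => j _; rewrite mxE.
by apply/matrixP => i j; rewrite mul_mx_diag !mxE mulrC.
Qed.

Lemma det_col_dup (A : comNzRingType) k (F : 'I_k -> nat -> A) (c : 'I_k -> nat) j1 j2 :
  j1 != j2 -> c j1 = c j2 -> \det (\matrix_(i, j) F i (c j)) = 0.
Proof.
move=> ne e; rewrite -det_tr; apply: (determinant_alternate ne) => i.
by rewrite !mxE e.
Qed.

(** The bound [t i >= i] holds for every increasing [t], and it applies both to
    the permutation and to its inverse. *)
Lemma homo_perm_id k (s : 'S_k) : {homo s : i j / (i < j)%N} -> s = 1%g.
Proof.
move=> hs; apply/permP => i; rewrite perm1; apply: val_inj => /=.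
have ge (t : 'S_k) : {homo t : i j / (i < j)%N} -> forall i : 'I_k, (i <= t i)%N.
  move=> ht [m mk]; elim: m mk => // m IH mk /=.
  have mk' := ltnW mk.
  by apply: leq_ltn_trans (IH mk') _; apply: ht => /=.
have hV : {homo (s^-1)%g : i j / (i < j)%N}.
  move=> a b ab; rewrite ltnNge; apply/negP; rewrite leq_eqVlt => /orP[/eqP/val_inj e|/hs].
    by move: ab; rewrite (perm_inj e) ltnn.
  by rewrite !permKV; move: ab; lia.
apply/eqP; rewrite eqn_leq ge // andbT.
by have := ge _ hV (s i); rewrite permK.
Qed.

(** * Total positivity of Hankel matrices of walks *)
Section TotalPositivity.
Variable A : comNzRingType.
Variable pos : A -> Prop.
Hypotheses (pos0 : pos 0) (pos1 : pos 1).
Hypotheses (posD : forall a b, pos a -> pos b -> pos (a + b)).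
Hypotheses (posM : forall a b, pos a -> pos b -> pos (a * b)).

Lemma pos_sum (I : finType) (F : I -> A) :
  (forall i, pos (F i)) -> pos (\sum_i F i).
Proof. by move=> h; elim/big_ind: _. Qed.

Lemma pos_prod (I : finType) (F : I -> A) :
  (forall i, pos (F i)) -> pos (\prod_i F i).
Proof. by move=> h; elim/big_ind: _. Qed.

Variables (k : nat) (r : 'I_k -> nat).

(** The rows [r] are fixed once and for all, since each step below acts on
    columns only and uses the entries in the rows [r] alone. *)
Definition col_TP (M : nat -> nat -> A) := forall c : 'I_k -> nat,
  {homo c : i j / (i < j)%N} -> pos (\det (\matrix_(i, j) M (r i) (c j))).

(** A minor of [M'] expands into minors of [M], one for each choice between the two
    terms in each column.  The hypothesis on [g0] and [g1] makes every such
    choice of columns weakly increasing: it gives a minor of [M] if it is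
    strictly increasing, and a determinant with two equal columns otherwise.
    This takes the place of the Cauchy-Binet formula. *)
Lemma col_TP_planar_step (M M' : nat -> nat -> A) (b0 b1 : nat -> A)
    (g0 g1 : nat -> nat) :
  (forall j, pos (b0 j)) -> (forall j, pos (b1 j)) ->
  (forall j j', (j < j')%N -> (maxn (g0 j) (g1 j) <= minn (g0 j') (g1 j'))%N) ->
  (forall i j, M' (r i) j = b0 j * M (r i) (g0 j) + b1 j * M (r i) (g1 j)) ->
  col_TP M -> col_TP M'.
Proof.
move=> p0 p1 hg eM TPM c hc.
under eq_mx do rewrite eM.
rewrite det_col_pair; apply: pos_sum => e.
pose g j := if e j then g0 (c j) else g1 (c j).
rewrite (_ : (\matrix_(i, j) _) =
   \matrix_(i, j) ((if e j then b0 (c j) else b1 (c j)) * M (r i) (g j))); last first.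
  by apply/matrixP => i j; rewrite !mxE /g; case: (e j).
rewrite det_col_scale; apply: posM; first by apply: pos_prod => j; case: (e j).
have gle (j j' : 'I_k) : (j < j')%N -> (g j <= g j')%N.
  by move=> /hc /hg; rewrite /g; case: (e j); case: (e j'); lia.
have [inj|] := boolP (injectiveb g).
  apply: TPM => j j' jj'; rewrite ltn_neqAle gle // andbT.
  by apply: contraTneq jj' => /(injectiveP _ inj) ->; rewrite ltnn.
by case/injectivePn => j [j' ne eg]; rewrite (@det_col_dup _ _ (fun i => M (r i)) g j j').
Qed.

(** Only the identity permutation can contribute to the determinant, because a
    permutation matching two increasing sequences is increasing. *)
Lemma col_TP_id : {homo r : i j / (i < j)%N} ->
  col_TP (fun i j => (i == j)%:R).
Proof.
move=> hr c hc; apply: pos_sum => s.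
have [->|ns] := eqVneq s 1%g.
  rewrite odd_perm1 mul1r; apply: pos_prod => i; rewrite mxE perm1.
  by case: eqP.
have [/forallP h|] := boolP [forall i, r i == c (s i)]; last first.
  rewrite negb_forall => /existsP[i ni].
  by rewrite (bigD1 i) //= mxE (negbTE ni) mul0r mulr0.
case/eqP: ns; apply: homo_perm_id => i j /hr.
rewrite (eqP (h i)) (eqP (h j)) => lt.
rewrite ltnNge; apply/negP; rewrite leq_eqVlt => /orP[/eqP/val_inj e|/hc].
  by move: lt; rewrite e ltnn.
by move: lt; lia.
Qed.

Variables u d : nat -> A.
Hypotheses (u_pos : forall j, pos (u j)) (d_pos : forall j, pos (d j)).
Hypothesis hr : {homo r : i j / (i < j)%N}.
Local Notation w := (walk u d).

(** The cut at the even time [-2t]: the columns [j < t] are the sources that start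
    later than the cut, and the column [t + e] is the vertex at height [2e]. *)
Definition source_cut (t i j : nat) : A :=
  if (j < t)%N then (i == j)%:R
  else if (i < t)%N then 0 else w (2 * (i - t)) (2 * (j - t)).

(** The cut at the odd time [-2t-1]: the vertices met now have odd heights, and the
    source [t] has not started, so that it keeps a column of its own. *)
Definition source_half_cut (t i j : nat) : A :=
  if (j <= t)%N then (i == j)%:R
  else if (i <= t)%N then 0 else w (2 * (i - t)).-1 (2 * (j - t)).-1.

Lemma source_half_step t :
  col_TP (source_cut t.+1) -> col_TP (source_half_cut t).
Proof.
apply: (@col_TP_planar_step _ _
   (fun j => if (j <= t)%N then 1 else u (2 * (j - t)).-2)
   (fun j => if (j <= t)%N then 0 else d (2 * (j - t)))
   id (fun j => if (j <= t)%N then j else j.+1)).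
- by move=> j; case: ifP.
- by move=> j; case: ifP.
- by move=> j j' jj'; case: ifP; case: ifP; lia.
move=> i j; rewrite /source_half_cut /source_cut ltnS.
case: (leqP j t) => jt; first by rewrite mul1r mul0r addr0.
rewrite ltnS; case: (leqP (r i) t) => it.
  by rewrite ltnNge ltnW ?ltnS //= !mulr0 addr0.
have [a ea] : exists a, r i = (t + a).+1 by exists (r i - t).-1; lia.
have [b eb] : exists b, j = (t + b).+1 by exists (j - t).-1; lia.
rewrite [(j.+1 < t.+1)%N]ltnNge (leqW jt) /= ea eb.
have -> : ((2 * ((t + a).+1 - t)).-1 = (2 * a).+1)%N by lia.
have -> : ((2 * ((t + b).+1 - t)).-2 = (2 * b))%N by lia.
have -> : ((2 * ((t + b).+1 - t)).-1 = (2 * b).+1)%N by lia.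
have -> : ((2 * ((t + b).+1 - t)) = (2 * b).+2)%N by lia.
have -> : ((2 * ((t + a).+1 - t.+1)) = (2 * a))%N by lia.
have -> : ((2 * ((t + b).+1 - t.+1)) = (2 * b))%N by lia.
by rewrite walkSS.
Qed.

Lemma source_step t : col_TP (source_half_cut t) -> col_TP (source_cut t).
Proof.
apply: (@col_TP_planar_step _ _
   (fun j => if (j <= t)%N then 1 else u (2 * (j - t)).-1)
   (fun j => if (j < t)%N then 0 else d (2 * (j - t)).+1)
   id (fun j => if (j < t)%N then j else j.+1)).
- by move=> j; case: ifP.
- by move=> j; case: ifP.
- by move=> j j' jj'; case: ifP; case: ifP; lia.
move=> i j; rewrite /source_half_cut /source_cut.
case: (ltnP j t) => jt; first by rewrite (ltnW jt) mul1r mul0r addr0.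
rewrite [(j.+1 <= t)%N]leqNgt ltnS jt /=.
have [b eb] : exists b, j = (t + b)%N by exists (j - t)%N; lia.
case: (ltngtP (r i) t) => it; rewrite ?it.
- rewrite mulr0 addr0; case: (leqP j t) => jt'; last by rewrite mulr0.
  by rewrite (_ : (r i == j) = false) ?mulr0 //; lia.
- have [a ea] : exists a, r i = (t + a).+1 by exists (r i - t).-1; lia.
  rewrite ea eb.
  have -> : ((2 * ((t + b).+1 - t)).-1 = (2 * b).+1)%N by lia.
  have -> : ((2 * (t + b - t)) = (2 * b))%N by lia.
  have -> : ((2 * ((t + a).+1 - t)).-1 = (2 * a).+1)%N by lia.
  have -> : ((2 * ((t + a).+1 - t)) = (2 * a).+2)%N by lia.
  case: b eb => [|b] eb.
    have -> : ((t + a).+1 == (t + 0)%N) = false by lia.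
    by rewrite addn0 leqnn mulr0 add0r muln0 walkS0.
  have -> : ((2 * b.+1) = (2 * b).+2)%N by lia.
  have -> : (t + b.+1 <= t)%N = false by lia.
  by rewrite walkSS.
- rewrite mulr0 addr0 subnn muln0 /=.
  case: (leqP j t) => jt'.
    have -> : j = t by lia.
    by rewrite subnn muln0 !eqxx ?leqnn mul1r.
  have -> : (2 * (j - t) == 0)%N = false by lia.
  by rewrite mulr0.
Qed.

(** At a time before the start of all the sources in [r], the cut gives the
    rows of the identity matrix; it is then moved forward to time 0. *)
Lemma walk_even_TP : col_TP (fun i j => w (2 * i) (2 * j)).
Proof.
pose n := (\max_i (r i)).+1.
have rn i : (r i < n)%N by rewrite ltnS leq_bigmax.
have base : col_TP (source_cut n).
  move=> c hc.
  rewrite (_ : (\matrix_(i, j) _) = \matrix_(i, j) (r i == c j)%:R).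
    exact: col_TP_id.
  apply/matrixP => i j; rewrite !mxE /source_cut rn; case: ltnP => // h.
  by have -> : (r i == c j) = false by have := rn i; lia.
have all_t t : col_TP (source_cut (n - t)).
  elim: t => [|t IH]; first by rewrite subn0.
  case: (ltnP t n) => tn; last by rewrite (_ : (n - t.+1 = n - t)%N) //; lia.
  apply: source_step; apply: source_half_step.
  by rewrite (_ : (n - t.+1).+1 = n - t)%N //; lia.
have := all_t n; rewrite subnn => h c hc.
have := h c hc; rewrite /source_cut.
by under eq_mx do rewrite !subn0.
Qed.

(** The cut at the even time [2t]: the columns [j < t] are the sinks that are already
    reached, and the column [t + e] is the vertex at height [2e]. *)
Definition sink_cut (t i j : nat) : A :=
  if (j < t)%N then w (2 * (i + j)) 0 else w (2 * (i + t)) (2 * (j - t)).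

(** The cut at the odd time [2t+1]; the sink [t] has been reached. *)
Definition sink_half_cut (t i j : nat) : A :=
  if (j <= t)%N then w (2 * (i + j)) 0
  else w (2 * (i + t)).+1 (2 * (j - t)).-1.

Lemma sink_half_step t : col_TP (sink_cut t) -> col_TP (sink_half_cut t).
Proof.
apply: (@col_TP_planar_step _ _
   (fun j => if (j <= t)%N then 0 else u (2 * (j - t)).-2)
   (fun j => if (j <= t)%N then 1 else d (2 * (j - t)))
   (fun j => if (j <= t)%N then j else j.-1) id).
- by move=> j; case: ifP.
- by move=> j; case: ifP.
- by move=> j j' jj'; case: ifP; case: ifP; lia.
move=> i j; rewrite /sink_half_cut /sink_cut.
case: (leqP j t) => jt.
  rewrite mul0r add0r mul1r; case: ltnP => // tj.
  have -> : j = t by lia.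
  by rewrite subnn muln0.
rewrite [(j < t)%N]ltnNge (ltnW jt) /=.
have -> : (j.-1 < t)%N = false by lia.
have [b eb] : exists b, j = (t + b).+1 by exists (j - t).-1; lia.
rewrite eb.
have -> : ((2 * ((t + b).+1 - t)).-2 = (2 * b))%N by lia.
have -> : ((2 * ((t + b).+1 - t)).-1 = (2 * b).+1)%N by lia.
have -> : ((2 * ((t + b).+1 - t)) = (2 * b).+2)%N by lia.
by have -> : ((2 * ((t + b).+1.-1 - t)) = (2 * b))%N by lia.
Qed.

Lemma sink_step t : col_TP (sink_half_cut t) -> col_TP (sink_cut t.+1).
Proof.
apply: (@col_TP_planar_step _ _
   (fun j => if (j <= t.+1)%N then 0 else u (2 * (j - t.+1)).-1)
   (fun j => if (j <= t)%N then 1 else d (2 * (j - t.+1)).+1)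
   (fun j => if (j <= t)%N then j else j.-1) id).
- by move=> j; case: ifP.
- by move=> j; case: ifP.
- by move=> j j' jj'; case: ifP; case: ifP; lia.
move=> i j; rewrite /sink_half_cut /sink_cut ltnS.
case: (leqP j t) => jt.
  by rewrite (leq_trans jt) // mul0r add0r mul1r.
have [b eb] : exists b, j = (t + b).+1 by exists (j - t).-1; lia.
rewrite eb.
have -> : ((2 * ((t + b).+1 - t)).-1 = (2 * b).+1)%N by lia.
have -> : ((2 * ((t + b).+1 - t.+1)) = (2 * b))%N by lia.
have -> : (2 * (r i + t.+1) = (2 * (r i + t)).+2)%N by lia.
case: b eb => [|b] eb.
  by rewrite addn0 leqnn mul0r add0r muln0 walkS0.
have -> : ((t + b.+1).+1 <= t.+1)%N = false by lia.
have -> : ((t + b.+1).+1.-1 <= t)%N = false by lia.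
have -> : ((2 * b.+1) = (2 * b).+2)%N by lia.
by rewrite walkSS.
Qed.

(** When the cut lies beyond all the columns in question, these columns are sinks
    and the minor is a minor of the Hankel matrix. *)
Theorem walk_Hankel_TP : col_TP (fun i j => w (2 * (i + j)) 0).
Proof.
have all_t t : col_TP (sink_cut t).
  elim: t => [|t IH]; last exact/sink_step/sink_half_step.
  move=> c hc; have := walk_even_TP hc; rewrite /sink_cut.
  by under [X in _ -> pos (\det X)]eq_mx do rewrite subn0 addn0.
move=> c hc; have := all_t (\max_j (c j)).+1 c hc; rewrite /sink_cut.
rewrite (_ : (\matrix_(i, j) _) = \matrix_(i, j) w (2 * (r i + c j)) 0) //.
by apply/matrixP => i j; rewrite !mxE ltnS leq_bigmax.
Qed.

End TotalPositivity.

(** * Words with zeros, and the insertion of a letter *)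
Section Words.
Local Open Scope nat_scope.
Implicit Types (v x y m N : nat) (w l r : seq nat).

Definition zeros w := count_mem 0 w.
Arguments zeros : simpl never.

(** The pattern 31-2, counted by the position of its descent.  The letters counted
    range over the whole tail: its first letter [y] is excluded by [y < c]. *)
Fixpoint count31_2 w := if w is x :: t then
  (if t is y :: _ then count (fun c => y < c < x) t else 0) + count31_2 t else 0.

Fixpoint records m w := if w is x :: t then (m < x) + records (maxn m x) t else 0.

(** [up] says whether the first step of the word is an ascent. *)
Fixpoint zigzag (up : bool) w := if w is x :: t then
  (if t is y :: _ then (if up then x < y else y < x) else true) && zigzag (~~ up) t
  else true.

(** The alternating sum: in a zigzag word starting with an ascent, the sum of the
    valleys minus the sum of the peaks. *)
Fixpoint altsum w : int := if w is x :: t then (x%:Z - altsum t)%R else 0%R.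

Definition above v w := all (fun c => (c == 0) || (v < c)) w.
Definition no_zero_pair w := sorted (fun a b => (0 < a) || (0 < b)) w.

Lemma above_count v w x y : above v w -> x <= v ->
  count (fun c => x < c < y) w = count (fun c => 0 < c < y) w.
Proof.
move=> /allP av xv; apply: eq_in_count => c /av /orP[/eqP->|vc]; first by rewrite !ltn0.
by congr (_ && _); lia.
Qed.

Lemma count_below v w y : above v w -> count (fun c => y < c < v) w = 0.
Proof.
move=> /allP av; apply/eqP; rewrite -leqn0 leqNgt -has_count; apply/hasPn => c.
by move=> /av /orP[/eqP->|vc]; rewrite ?ltn0 //; lia.
Qed.

Lemma count_under0 w y : count (fun c => y < c < 0) w = 0.
Proof. by rewrite (eq_count (a2 := pred0)) ?count_pred0 // => c; rewrite ltn0 andbF. Qed.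

Lemma above_tail v x w : above v (x :: w) -> above v w.
Proof. by case/andP. Qed.

Lemma no_zero_pair_tail x w : no_zero_pair (x :: w) -> no_zero_pair w.
Proof. exact: path_sorted. Qed.

(** The new letter [v] plays the role of 2 for each descent to a zero on its left,
    and every zero up to the chosen one ends such a descent, unless it is the
    first letter of the word; this is what the term on the left compensates.
    No other occurrence is created or destroyed, since the chosen zero and [v]
    are both below all the other nonzero letters.  The equation has this form,
    rather than a hypothesis that the word begins with a zero, to make the
    induction on [l] go through. *)
Lemma count31_2_insert_peak v l r : 0 < v -> above v (l ++ 0 :: r) ->
  no_zero_pair (l ++ 0 :: r) ->
  count31_2 (l ++ [:: 0, v, 0 & r]) + (head 1 (l ++ [:: 0]) == 0) =
  count31_2 (l ++ 0 :: r) + zeros (l ++ [:: 0]).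
Proof.
move=> v0; elim: l => [|x l IH].
  move=> av _.
  have -> : count31_2 ([::] ++ [:: 0, v, 0 & r]) = count (fun c => v < c < 0) [:: v, 0 & r]
     + (count (fun c => 0 < c < v) (0 :: r) + count31_2 (0 :: r)) by [].
  by rewrite (count_below _ av) count_under0.
rewrite !cat_cons => av hz.
have := IH (above_tail av) (no_zero_pair_tail hz).
have -> : zeros (x :: l ++ [:: 0]) = (x == 0) + zeros (l ++ [:: 0]) by [].
set y := head 1 (l ++ [:: 0]).
have E r' : count31_2 (x :: l ++ 0 :: r') =
    count (fun c => y < c < x) (l ++ 0 :: r') + count31_2 (l ++ 0 :: r').
  by rewrite /y; case: l {IH av hz y}.
rewrite !E !count_cat /=.
have hxy : (y < v < x) = (y == 0) :> bool.
  have : ((x == 0) || (v < x)) && ((y == 0) || (v < y)) && ((0 < x) || (0 < y)).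
    move: av hz; rewrite /y; case: l {IH y E} => [|y l] /=.
      by move=> /andP[-> _] /andP[h3 _]; rewrite h3.
    by move=> /and3P[-> h1 _] /andP[h3 _]; rewrite h1 h3.
  by lia.
by rewrite hxy; lia.
Qed.

(** As for a peak, except that the descent to the chosen zero now ends in [v] itself,
    so that [v] is not the 2 of a pattern with this descent. *)
Lemma count31_2_insert_valley v l r : 0 < v -> above v (l ++ 0 :: r) ->
  no_zero_pair (l ++ 0 :: r) ->
  count31_2 (l ++ v :: r) + (head 1 l == 0) = count31_2 (l ++ 0 :: r) + zeros l.
Proof.
move=> v0; elim: l => [|x l IH].
  move=> /above_tail ar _; rewrite /= !addn0.
  case: r ar => [//|c r] ar; rewrite (count_below _ ar).
  have a0 : above 0 (c :: r) by apply/allP => b _; case: b.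
  by rewrite (count_below _ a0).
rewrite !cat_cons => av hz.
have := IH (above_tail av) (no_zero_pair_tail hz).
have -> : zeros (x :: l) = (x == 0) + zeros l by [].
case: l {IH} av hz => [|y l].
  move=> av; have ar : above v r := above_tail (above_tail av).
  move: av => /= /andP[hx _] /andP[hx' _].
  rewrite !ltnn /= (above_count _ ar (leqnn v)).
  by lia.
move=> av hz; set L := count31_2 (y :: l ++ v :: r); set L0 := count31_2 (y :: l ++ 0 :: r).
have -> : count31_2 (x :: y :: l ++ v :: r) =
   count (fun c => y < c < x) (y :: l ++ v :: r) + L by [].
have -> : count31_2 (x :: y :: l ++ 0 :: r) =
   count (fun c => y < c < x) (y :: l ++ 0 :: r) + L0 by [].
rewrite /= !count_cat /=.
have hxy : (y < v < x) = (y == 0) :> bool.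
  by move: av hz => /= /and3P[h1 h2 _] /andP[h3 _]; lia.
by rewrite hxy /L /L0 /=; lia.
Qed.

Lemma records_above v r : above v r -> records v r = records 0 r.
Proof.
elim: r => //= x r IH /andP[/orP[/eqP->|vx] ar]; first by rewrite maxn0 !ltn0 IH.
by rewrite vx max0n (maxn_idPr (ltnW vx)); congr (_ + _); lia.
Qed.

(** The insertion of [v] changes the records only if nothing larger precedes it, and it
    never hides a later record. *)
Lemma records_insert_peak v m l r : 0 < v -> above v (m :: l ++ 0 :: r) ->
  records m (l ++ [:: 0, v, 0 & r]) =
  records m (l ++ 0 :: r) + ((m == 0) && all (pred1 0) l).
Proof.
move=> v0; elim: l m => [|x l IH] m /=; last first.
  move=> /and3P[hm hx a]; rewrite IH /=.
    by case: all; lia.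
  by rewrite a andbT; lia.
move=> /andP[hm ar]; rewrite !maxn0 !add0n andbT.
case/orP: hm => [/eqP->|vm]; first by rewrite max0n (records_above ar) v0 addnC.
by rewrite (maxn_idPl (ltnW vm)); lia.
Qed.

Lemma records_insert_valley v m l r : above v (m :: l ++ 0 :: r) ->
  has (ltn 0) (m :: l) ->
  records m (l ++ v :: r) = records m (l ++ 0 :: r).
Proof.
elim: l m => [|x l IH] m /=.
  move=> /andP[hm ar] m0; have vm : v < m by lia.
  by rewrite maxn0 (maxn_idPl (ltnW vm)); lia.
move=> /and3P[hm hx a] h; rewrite IH //=; first by rewrite a andbT; lia.
by move: h; case: has; lia.
Qed.

Lemma records_gt0 m w : has (ltn m) w -> 0 < records m w.
Proof.
elim: w m => //= x w IH m; by case: ltnP => //= _ /IH.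
Qed.

Lemma altsum_cat l r : altsum (l ++ r) = (altsum l + (-1) ^+ odd (size l) * altsum r)%R.
Proof.
elim: l => [|x l /= ->] /=; first by rewrite add0r mul1r.
by case: odd; rewrite /= ?expr1 ?expr0; ring.
Qed.

Lemma zigzag_cat b l x r :
  zigzag b (l ++ x :: r) = zigzag b (l ++ [:: x]) && zigzag (b (+) odd (size l)) (x :: r).
Proof.
elim: l b => [|y l IH] b; first by rewrite addbF.
rewrite !cat_cons /= IH -andbA addbN -addNb; congr (_ && _).
by case: l {IH}.
Qed.

Lemma zigzag_no_zero_pair b w : zigzag b w -> no_zero_pair w.
Proof.
elim: w b => // x [|y w] // IH b /andP[h /IH h2]; apply/andP; split=> //.
by case: b h; lia.
Qed.

Lemma zigzag_zero l r : zigzag true (l ++ 0 :: r) ->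
  [/\ ~~ odd (size l), l != [::] -> 0 < last 0 l & r != [::] -> 0 < head 0 r].
Proof.
rewrite zigzag_cat => /andP[hl hr].
have [ev lastl] : ~~ odd (size l) /\ (l != [::] -> 0 < last 0 l).
  elim/last_ind: l hl {hr} => [//|l y _].
  rewrite cat_rcons zigzag_cat size_rcons last_rcons /= => /and3P[_ + _].
  by case: odd.
split=> //; move: hr; rewrite (negbTE ev) addbF.
by case: r => //= y r /andP[].
Qed.

(** The decompositions of [w] at its zeros. *)
Fixpoint splits w : seq (seq nat * seq nat) := if w is x :: t then
  (if x == 0 then [:: ([::], t)] else [::]) ++ [seq (x :: lr.1, lr.2) | lr <- splits t]
  else [::].

Lemma mem_splits w lr : (lr \in splits w) = (w == lr.1 ++ 0 :: lr.2).
Proof.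
elim: w lr => [|x w IH] [l r] /=; first by case: l.
have M : ((l, r) \in [seq (x :: lr.1, lr.2) | lr <- splits w]) =
    (if l is y :: l' then (x == y) && (w == l' ++ 0 :: r) else false).
  apply/mapP/idP => [[[l' r'] + [-> ->]]|]; first by rewrite IH eqxx.
  case: l => // y l' /andP[/eqP -> hw]; exists (l', r) => //.
  by rewrite IH.
rewrite mem_cat M; case: l {M} => [|y l] /=.
  by rewrite orbF eqseq_cons; case: (x == 0) => //=; rewrite inE xpair_eqE eqxx eq_sym.
by rewrite eqseq_cons; case: (x == 0); rewrite //= inE xpair_eqE.
Qed.

Lemma uniq_splits w : uniq (splits w).
Proof.
elim: w => //= x w IH; rewrite cat_uniq map_inj_uniq ?IH ?andbT; last first.
  by move=> [a b] [c e] [-> ->].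
case: (x == 0); rewrite //= -all_predC ?andbT; last by apply/allP.
by apply/allP => _ /mapP[lr _ ->]; rewrite inE.
Qed.

(** The words obtained by inserting [v] as a peak or as a valley.  The filter keeps the
    zeros that have another zero on each side. *)
Definition children v w :=
  [seq lr.1 ++ [:: 0, v, 0 & lr.2] | lr <- splits w] ++
  [seq lr.1 ++ v :: lr.2 | lr <- splits w & (0 < zeros lr.1) && (0 < zeros lr.2)].

(** The words with the [k] largest letters of [1..N] inserted. *)
Fixpoint words N k := if k is k'.+1 then
  flatten [seq children (N - k') w | w <- words N k'] else [:: [:: 0]].

(** The words reached when exactly the letters above [v] are present; see
    [mem_words]. *)
Definition valid N v w := [&& head 1 w == 0, last 1 w == 0, zigzag true w
  & perm_eq [seq c <- w | 0 < c] (iota v.+1 (N - v))].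

End Words.
Arguments zeros : simpl never.

(** The decomposition of [w] at its zero number [t], counted from 0, has [t] zeros
    on the left. *)
Lemma sum_splits (A : nmodType) w (F : nat -> A) :
  \sum_(lr <- splits w) F (zeros lr.1) = \sum_(0 <= t < zeros w) F t.
Proof.
elim: w F => [|x w IH] F; first by rewrite big_nil big_geq.
have -> : zeros (x :: w) = ((x == 0) + zeros w)%N by [].
rewrite [splits _]/= big_cat big_map /=.
rewrite [X in _ + X](eq_bigr (fun lr => F ((x == 0) + zeros lr.1)%N)) //.
case: (x == 0) => /=; last by rewrite big_nil add0r -IH.
by rewrite big_seq1 add1n big_nat_recl //; congr (_ + _); rewrite -IH.
Qed.

(** * The words built by insertion are the valid words, each built once *)
Section ValidWords.
Local Open Scope nat_scope.
Implicit Types (v x y m N : nat) (w l r : seq nat).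

Lemma zeros_cat l r : zeros (l ++ r) = zeros l + zeros r.
Proof. exact: count_cat. Qed.

Lemma zeros_cons x r : zeros (x :: r) = (x == 0) + zeros r.
Proof. by []. Qed.

Lemma mem_valid N v w c : v <= N -> valid N v w ->
  (c \in w) = (c == 0) && (0 \in w) || (v < c <= N).
Proof.
move=> vN /and4P[_ _ _ /perm_mem/(_ c)].
rewrite mem_filter mem_iota => E.
case: (posnP c) => [->|c0] /=; first by rewrite ?ltn0 ?orbF.
by rewrite c0 /= in E; rewrite E; lia.
Qed.

Lemma valid_above N v w : v <= N -> valid N v w -> above v w.
Proof.
move=> vN h; apply/allP => c; rewrite (mem_valid _ vN h); lia.
Qed.

Lemma valid_peak N v l r : 0 < v <= N ->
  valid N v.-1 (l ++ [:: 0, v, 0 & r]) = valid N v (l ++ 0 :: r).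
Proof.
move=> /andP[v0 vN]; rewrite /valid; congr [&& _, _, _ & _].
- by case: l.
- by rewrite !last_cat.
- rewrite (zigzag_cat true l 0 [:: v, 0 & r]).
  case: (boolP (odd (size l))) => ev.
    rewrite /= andbF; apply/esym/negbTE.
    by apply: contraL ev => /zigzag_zero[].
  by rewrite (zigzag_cat true l 0 r) (negbTE ev) /= v0.
rewrite !filter_cat /= v0 prednK // (_ : N - v.-1 = (N - v).+1); last by lia.
by rewrite /= -cat1s perm_catCA perm_cons.
Qed.

Lemma valid_valley N v l r : 0 < v <= N -> l != [::] -> r != [::] ->
  ~~ odd (size l) -> above v (l ++ r) ->
  valid N v.-1 (l ++ v :: r) = valid N v (l ++ 0 :: r).
Proof.
move=> /andP[v0 vN] l0 r0 ev ab; rewrite /valid; congr [&& _, _, _ & _].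
- by case: l l0 {ev ab}.
- by rewrite !last_cat; case: r r0 ab.
- case/lastP: l l0 ev ab => [//|l y _]; rewrite size_rcons /= negbK => od.
  case: r r0 => [//|c r _] /allP ab.
  have hy : (y == 0) || (v < y) by apply: ab; rewrite mem_cat mem_rcons mem_head.
  have hc : (c == 0) || (v < c) by apply: ab; rewrite mem_cat mem_head orbT.
  rewrite !cat_rcons (zigzag_cat true l y [:: v, c & r]).
  rewrite (zigzag_cat true l y [:: 0, c & r]) od /=.
  congr [&& _, _, _ & _]; lia.
rewrite !filter_cat /= v0 prednK // (_ : N - v.-1 = (N - v).+1); last by lia.
by rewrite /= -cat1s perm_catCA perm_cons.
Qed.

Lemma zeros_left N v l x r : l != [::] -> valid N v (l ++ x :: r) -> 0 < zeros l.
Proof. by case: l => // y l _ /and4P[/= /eqP-> _ _ _]. Qed.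

Lemma zeros_right N v l x r : r != [::] -> valid N v (l ++ x :: r) -> 0 < zeros r.
Proof.
case/lastP: r => // r y _ /and4P[_ + _ _].
by rewrite last_cat /= last_rcons => /eqP->; rewrite -cats1 zeros_cat addn1.
Qed.

Lemma zeros_eq0l N v l x r : valid N v (l ++ x :: r) -> (zeros l == 0) = (l == [::]).
Proof.
by move=> h; case: (eqVneq l [::]) => [->//|/zeros_left/(_ h)]; case: zeros.
Qed.

Lemma zeros_eq0r N v l x r : valid N v (l ++ x :: r) -> (zeros r == 0) = (r == [::]).
Proof.
by move=> h; case: (eqVneq r [::]) => [->//|/zeros_right/(_ h)]; case: zeros.
Qed.

Lemma valid_children N v w w' : 0 < v <= N -> valid N v w ->
  w' \in children v w -> valid N v.-1 w'.
Proof.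
move=> hv hw; have vN : v <= N by lia.
have ab := valid_above vN hw.
rewrite mem_cat => /orP[] /mapP[[l r] /=].
  by rewrite mem_splits /= => /eqP e ->; rewrite valid_peak // -e.
rewrite mem_filter mem_splits /= => /andP[/andP[l0 r0] /eqP e] ->.
rewrite valid_valley -?e //.
- by case: l l0 {e}.
- by case: r r0 {e}.
- by move: hw; rewrite e => /and4P[_ _ /zigzag_zero[]].
- by move: ab; rewrite e /above !all_cat /= => /andP[-> ->].
Qed.

(** Removing the smallest nonzero letter [v] leads back to a parent: at an odd
    position [v] is a peak, whose two neighbours are smaller and hence zeros;
    at an even position it is a valley. *)
Lemma valid_parent N v w' : 0 < v <= N -> valid N v.-1 w' ->
  exists2 w, valid N v w & w' \in children v w.
Proof.
move=> hv hw'; have hv' : v.-1 <= N by lia.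
have vw : v \in w' by rewrite (mem_valid _ hv' hw'); lia.
have uw : count_mem v w' = 1.
  have -> : count_mem v w' = count_mem v [seq c <- w' | 0 < c].
    rewrite count_filter; apply: eq_count => c /=.
    by case: eqP => // ->; case/andP: hv => ->.
  case/and4P: hw' => _ _ _ /seq.permP ->.
  by rewrite count_uniq_mem ?iota_uniq // mem_iota; lia.
case/splitPr: vw hw' uw => l r hw'.
rewrite count_cat /= eqxx => uw.
have ab : above v (l ++ r).
  apply/allP => c hc; have hc' : c \in l ++ v :: r.
    by move: hc; rewrite !mem_cat inE => /orP[->|->]; rewrite ?orbT.
  move: hc'; rewrite (mem_valid _ hv' hw') => /orP[/andP[->]//|h].
  have : v \notin l ++ r.
    by apply/count_memPn; move: uw; rewrite count_cat add1n addnS => -[->].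
  by case: (eqVneq c v) => [<-|ne _]; [rewrite hc | lia].
have [hd la zz _] := and4P hw'.
have l0 : l != [::] by case: l hd {hw' uw ab la zz} => //= /eqP; lia.
have r0 : r != [::].
  by case: r la {hw' uw ab hd zz} => //; rewrite last_cat /= => /eqP; lia.
have [od|ev] := boolP (odd (size l)); last first.
  exists (l ++ 0 :: r); first by rewrite -valid_valley.
  rewrite mem_cat; apply/orP; right; apply/mapP; exists (l, r) => //.
  rewrite mem_filter mem_splits /= eqxx andbT.
  by rewrite (zeros_left l0 hw') (zeros_right r0 hw').
case/lastP: l l0 od ab zz hw' {uw hd la} => // l y _.
rewrite size_rcons /= => od /allP ab.
rewrite cat_rcons (zigzag_cat true l y) (negbTE od) => zz hw'.
case: r r0 zz ab hw' => // c r _ /= /and4P[_ yv cv _] ab hw'.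
have y0 : y = 0.
  by have := ab y; rewrite mem_cat mem_rcons mem_head /= => /(_ isT); lia.
have c0 : c = 0.
  by have := ab c; rewrite mem_cat mem_head orbT /= => /(_ isT); lia.
move: hw'; rewrite y0 c0 valid_peak // => hw.
exists (l ++ 0 :: r) => //.
rewrite mem_cat; apply/orP; left; apply/mapP; exists (l, r) => //.
by rewrite mem_splits.
Qed.

Lemma valid_top N w : valid N N w = (w == [:: 0]).
Proof.
apply/idP/eqP => [/and4P[hd _ zz]|->]; last by rewrite /valid subnn.
rewrite subnn => /perm_nilP e.
have {}e : all (pred1 0) w.
  apply/allP => c cw; have : c \notin [seq c <- w | 0 < c] by rewrite e.
  by rewrite mem_filter cw andbT -leqNgt leqn0.
case: w hd zz e => // x [|y w] /= /eqP -> //.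
by move=> /andP[y0 _] /and3P[_ /eqP yz _]; move: y0; rewrite yz.
Qed.

Lemma mem_words N k w : k <= N -> (w \in words N k) = valid N (N - k) w.
Proof.
elim: k w => [|k IH] w kN; first by rewrite subn0 valid_top inE.
have hv : 0 < N - k <= N by lia.
rewrite /= subnS; apply/flatten_mapP/idP => [[w0]|].
  by rewrite (IH _ (ltnW kN)); apply: valid_children.
by move=> /(valid_parent hv)[w0 h0 hw]; exists w0; rewrite ?(IH _ (ltnW kN)).
Qed.

(** The parent can be recovered from a child: the letter before [v] is a zero if [v] was
    inserted as a peak, and a larger letter if [v] was inserted as a valley. *)
Lemma children_inj N v w1 w2 w : 0 < v <= N -> valid N v w1 -> valid N v w2 ->
  w \in children v w1 -> w \in children v w2 -> w1 = w2.
Proof.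
move=> hv h1 h2.
have dec w0 : valid N v w0 -> w \in children v w0 -> exists l r,
    [/\ w = l ++ v :: r, v \notin l, v \notin r &
     w0 = if last 1 l == 0 then take (size l).-1 l ++ r else l ++ 0 :: r].
  move=> h0; have vw0 : v \notin w0 by rewrite (mem_valid _ _ h0); lia.
  rewrite mem_cat => /orP[] /mapP[[l r] /=].
    rewrite mem_splits /= => /eqP e ->; exists (rcons l 0), (0 :: r).
    move: vw0; rewrite e mem_cat inE => vw0.
    rewrite cat_rcons mem_rcons !inE last_rcons size_rcons /= -cats1 take_size_cat //.
    by split=> //; move: vw0; case: (v \in l); case: (v \in r); lia.
  rewrite mem_filter mem_splits /= => /andP[/andP[l0 r0] /eqP e] ->; exists l, r.
  move: vw0; rewrite e mem_cat inE => vw0; split=> //.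
  + by move: vw0; case: (v \in l).
  + by move: vw0; case: (v \in r); lia.
  move: h0; rewrite e => /and4P[_ _ /zigzag_zero[_ la _] _].
  have {}l0 : l != [::] by case: l l0 {e vw0 la}.
  move: (la l0); case/lastP: l l0 {e vw0 la} => // l y _.
  by rewrite !last_rcons; case: y.
move=> /(dec _ h1)[l1 [r1 [e1 nl nr ->]]] /(dec _ h2)[l2 [r2 [e2 _ _ ->]]].
move: e2; rewrite e1 => /eqP; rewrite eqseq_pivotl //.
by move=> /andP[/eqP-> /eqP->].
Qed.

Lemma uniq_children N v w : 0 < v <= N -> valid N v w -> uniq (children v w).
Proof.
move=> hv h0; have vw0 : v \notin w by rewrite (mem_valid _ _ h0); lia.
have nv lr : lr \in splits w -> v \notin lr.1 /\ v \notin lr.2.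
  rewrite mem_splits => /eqP e; move: vw0; rewrite e mem_cat inE.
  by case: (v \in lr.1) => //; case: (v \in lr.2); lia.
rewrite cat_uniq; apply/and3P; split.
- rewrite map_inj_in_uniq ?uniq_splits // => -[l r] [l' r'] /nv[/= nl nr] /nv[/= nl' nr'].
  have E s t : s ++ [:: 0, v, 0 & t] = rcons s 0 ++ v :: (0 :: t) by rewrite cat_rcons.
  move=> /eqP; rewrite !E eqseq_pivot2l ?mem_rcons ?inE ?(negbTE nl) ?(negbTE nl') ?orbF;
    try lia.
  by rewrite eqseq_rcons !eqseq_cons !eqxx andbT => /andP[/eqP-> /eqP->].
- apply/hasPn => w' /mapP[[l r]]; rewrite mem_filter => /andP[/= /andP[l0 _] hlr] ->.
  have [/= nl nr] := nv _ hlr; move: hlr; rewrite mem_splits => /eqP/= e.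
  apply/mapP => -[[l' r'] /nv[/= nl' nr'] /eqP].
  rewrite (_ : l' ++ _ = rcons l' 0 ++ v :: (0 :: r')); last by rewrite cat_rcons.
  rewrite eqseq_pivot2l ?mem_rcons ?inE ?(negbTE nl') ?orbF //; try lia.
  move=> /andP[/eqP el _].
  move: h0; rewrite e => /and4P[_ _ /zigzag_zero[_ + _] _].
  by rewrite el last_rcons; case: l' {el nl'} => [|a l'] /(_ isT).
rewrite map_inj_in_uniq ?filter_uniq ?uniq_splits // => -[l r] [l' r'].
rewrite !mem_filter => /andP[_ /nv[/= nl nr]] /andP[_ /nv[/= nl' nr']].
by move=> /eqP; rewrite eqseq_pivot2l // => /andP[/eqP-> /eqP->].
Qed.

Lemma uniq_flatten_map (S T : eqType) (F : S -> seq T) (s : seq S) :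
  uniq s -> {in s, forall a, uniq (F a)} ->
  {in s &, forall a b c, c \in F a -> c \in F b -> a = b} ->
  uniq (flatten [seq F a | a <- s]).
Proof.
elim: s => //= a s IH /andP[nas us] uF dF; rewrite cat_uniq uF ?mem_head //=.
rewrite IH //; last 2 first.
- by move=> b bs; apply: uF; rewrite inE bs orbT.
- by move=> b c bs cs; apply: dF; rewrite inE ?bs ?cs orbT.
rewrite andbT; apply/hasPn => c /flatten_mapP[b bs cb]; apply/negP => ca.
move: nas; rewrite (dF a b _ _ c ca cb) ?mem_head ?bs //.
by rewrite inE bs orbT.
Qed.

Lemma uniq_words N k : k <= N -> uniq (words N k).
Proof.
elim: k => //= k IH kN; have hv : 0 < N - k <= N by lia.
apply: uniq_flatten_map => [|w|w1 w2]; first exact: IH (ltnW kN).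
  by rewrite (mem_words _ (ltnW kN)); apply: uniq_children.
by rewrite !(mem_words _ (ltnW kN)) => h1 h2 c; apply: children_inj h1 h2.
Qed.

End ValidWords.

(** * Effect of one insertion on the statistics *)
Section ChildStatistics.
Local Open Scope nat_scope.
Variables (N v : nat) (l r : seq nat).
Hypotheses (v_gt0 : 0 < v) (v_le : v <= N) (lr_valid : valid N v (l ++ 0 :: r)).

Let lr_above : above v (l ++ 0 :: r) := valid_above v_le lr_valid.

Let rl_above : above v (rev r ++ 0 :: rev l).
Proof. by rewrite -cat_rcons -rev_cons -rev_cat /above all_rev. Qed.

Let lr_zigzag : zigzag true (l ++ 0 :: r).
Proof. by case/and4P: lr_valid. Qed.

Let lr_pairs : no_zero_pair (l ++ 0 :: r) := zigzag_no_zero_pair lr_zigzag.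

Let rl_pairs : no_zero_pair (rev r ++ 0 :: rev l).
Proof.
rewrite -cat_rcons -rev_cons -rev_cat /no_zero_pair rev_sorted.
by apply: sub_sorted lr_pairs => a b; rewrite orbC.
Qed.

Let head_l : head 1 (l ++ [:: 0]) = 0.
Proof. by case/and4P: lr_valid => /eqP + _ _ _; case: l. Qed.

Let head_r : head 1 (rev r ++ [:: 0]) = 0.
Proof.
case/and4P: lr_valid => _ /eqP + _ _; rewrite last_cat /=.
by case/lastP: r => // s y; rewrite last_rcons rev_rcons.
Qed.

Lemma zeros_rev w : zeros (rev w) = zeros w.
Proof. by rewrite /zeros count_rev. Qed.

Lemma zeros_size w : zeros w <= size w.
Proof. exact: count_size. Qed.

Lemma count31_2_child_peak :
  count31_2 (l ++ [:: 0, v, 0 & r]) = count31_2 (l ++ 0 :: r) + zeros l.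
Proof.
have := count31_2_insert_peak v_gt0 lr_above lr_pairs.
by rewrite head_l eqxx zeros_cat /= => /eqP; rewrite addnA eqn_add2r => /eqP.
Qed.

Lemma count31_2_rev_child_peak :
  count31_2 (rev (l ++ [:: 0, v, 0 & r])) = count31_2 (rev (l ++ 0 :: r)) + zeros r.
Proof.
have := count31_2_insert_peak v_gt0 rl_above rl_pairs.
rewrite head_r eqxx zeros_cat zeros_rev /= => /eqP; rewrite addnA eqn_add2r => /eqP.
by rewrite !rev_cat !rev_cons !cat_rcons.
Qed.

(** No two zeros are adjacent in a valid word, so a nonempty part on the left of a zero
    contains a larger letter. *)
Lemma all_zero_left : all (pred1 0) l = (zeros l == 0).
Proof.
rewrite (zeros_eq0l lr_valid); case: (zigzag_zero lr_zigzag) => _ + _.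
case/lastP: l => [//|s y]; rewrite last_rcons all_rcons => la.
have {}la : 0 < y by apply: la; case: (s).
by case: y la => // y _; case: (s).
Qed.

Lemma all_zero_right : all (pred1 0) r = (zeros r == 0).
Proof.
rewrite (zeros_eq0r lr_valid); case: (zigzag_zero lr_zigzag) => _ _.
by case: r => [//|[|y] s] //= /(_ isT).
Qed.

Lemma records_child_peak :
  records 0 (l ++ [:: 0, v, 0 & r]) = records 0 (l ++ 0 :: r) + (zeros l == 0).
Proof. by rewrite (records_insert_peak v_gt0) ?all_zero_left. Qed.

Lemma records_rev_child_peak :
  records 0 (rev (l ++ [:: 0, v, 0 & r])) =
  records 0 (rev (l ++ 0 :: r)) + (zeros r == 0).
Proof.
rewrite !rev_cat !rev_cons !cat_rcons.
by rewrite (records_insert_peak v_gt0) ?all_rev ?all_zero_right.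
Qed.

Lemma altsum_child_peak :
  altsum (l ++ [:: 0, v, 0 & r]) = (altsum (l ++ 0 :: r) - v%:Z)%R.
Proof.
have [ev _ _] := zigzag_zero lr_zigzag.
rewrite !altsum_cat (negbTE ev) /= expr0; ring.
Qed.

Lemma size_child_peak : (size (l ++ [:: 0, v, 0 & r]))./2 = (size (l ++ 0 :: r))./2.+1.
Proof. by rewrite !size_cat /= !addnS. Qed.

Section Valley.
Hypotheses (zl : 0 < zeros l) (zr : 0 < zeros r).

Let l_neq0 : l != [::]. Proof. by apply: contraTneq zl => ->. Qed.
Let r_neq0 : r != [::]. Proof. by apply: contraTneq zr => ->. Qed.

Lemma count31_2_child_valley :
  count31_2 (l ++ v :: r) = count31_2 (l ++ 0 :: r) + (zeros l).-1.
Proof.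
have := count31_2_insert_valley v_gt0 lr_above lr_pairs.
have -> : head 1 l = 0 by move: head_l; case: l l_neq0.
by rewrite eqxx; lia.
Qed.

Lemma count31_2_rev_child_valley :
  count31_2 (rev (l ++ v :: r)) = count31_2 (rev (l ++ 0 :: r)) + (zeros r).-1.
Proof.
have := count31_2_insert_valley v_gt0 rl_above rl_pairs.
have -> : head 1 (rev r) = 0.
  by move: head_r; case/lastP: r r_neq0 => // s y _; rewrite rev_rcons.
by rewrite eqxx zeros_rev !rev_cat !rev_cons !cat_rcons; lia.
Qed.

Lemma records_child_valley : records 0 (l ++ v :: r) = records 0 (l ++ 0 :: r).
Proof.
apply: records_insert_valley => //=.
have := all_zero_left; rewrite (gtn_eqF zl) => /negbT; rewrite -has_predC.
by move=> h; apply: sub_has h => -[].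
Qed.

Lemma records_rev_child_valley :
  records 0 (rev (l ++ v :: r)) = records 0 (rev (l ++ 0 :: r)).
Proof.
rewrite !rev_cat !rev_cons !cat_rcons; apply: records_insert_valley => //=.
rewrite has_rev.
have := all_zero_right; rewrite (gtn_eqF zr) => /negbT; rewrite -has_predC.
by move=> h; apply: sub_has h => -[].
Qed.

Lemma altsum_child_valley :
  altsum (l ++ v :: r) = (altsum (l ++ 0 :: r) + v%:Z)%R.
Proof.
have [ev _ _] := zigzag_zero lr_zigzag.
rewrite !altsum_cat (negbTE ev) /= expr0; ring.
Qed.

End Valley.
End ChildStatistics.

Lemma records_valid_gt0 N v w : (v < N)%N -> valid N v w ->
  (0 < records 0 w)%N /\ (0 < records 0 (rev w))%N.
Proof.
move=> vN hw; have Nw : N \in w by rewrite (mem_valid _ (ltnW vN) hw) leqnn vN orbT.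
have hN : has (ltn 0) w by apply/hasP; exists N => //=; lia.
by split; apply: records_gt0; rewrite ?has_rev.
Qed.

Lemma zeros_valid_gt1 N v w : (v < N)%N -> valid N v w -> (1 < zeros w)%N.
Proof.
move=> vN hw; have Nw : N \in w by rewrite (mem_valid _ (ltnW vN) hw) leqnn vN orbT.
case/splitPr: Nw hw => l r hw; have N0 : (0 < N)%N by lia.
have l0 : l != [::].
  by case: l hw => // /and4P[/= /eqP]; lia.
have r0 : r != [::].
  by case: r hw => // /and4P[_ + _ _]; rewrite last_cat /= => /eqP; lia.
have := zeros_left l0 hw; have := zeros_right r0 hw.
by rewrite zeros_cat zeros_cons; lia.
Qed.

(** * The sum over words as a sum over walks *)
Section Weights.
Variable A : comNzRingType.
Variables x f g h alpha beta p q : A.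

(** The exponent of [x] is one less than the number of peaks, which sit at the odd
    positions of [w]; for an alternating permutation this is [des].  The variable [h] is attached to both pattern counts
    because their sum is the statistic [D]. *)
Definition weight (w : seq nat) : A :=
  x ^+ (size w)./2.-1 * (f * alpha) ^+ (records 0 w).-1
  * (g * beta) ^+ (records 0 (rev w)).-1
  * (h * p) ^+ count31_2 w * (h * q) ^+ count31_2 (rev w).

(** The factor for a peak inserted at a zero with [a] zeros on its left and [b] on its
    right. *)
Definition peak_step (a b : nat) : A :=
  x * (f * alpha) ^+ (a == 0%N) * (g * beta) ^+ (b == 0%N) * (h * p) ^+ a * (h * q) ^+ b.

(** The first and the last zero cannot become valleys, whence the value 0. *)
Definition valley_step (a b : nat) : A :=
  if (0 < a)%N && (0 < b)%N then (h * p) ^+ a.-1 * (h * q) ^+ b.-1 else 0.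

(** The height [k] of the walk corresponds to [k + 2] zeros: just after the insertion of
    [N] the word is [0 N 0]. *)
Definition up_weight (k : nat) : A :=
  \sum_(0 <= t < k.+2) peak_step t (k.+1 - t).

Definition down_weight (k : nat) : A :=
  \sum_(0 <= t < k.+2) valley_step t (k.+1 - t).

Lemma weight_child_peak N v l r : (0 < v < N)%N -> valid N v (l ++ 0%N :: r) ->
  weight (l ++ [:: 0%N, v, 0%N & r]) =
  weight (l ++ 0%N :: r) * peak_step (zeros l) (zeros r).
Proof.
move=> /andP[v0 vN] hw; have vN' := ltnW vN.
have [r1 r2] := records_valid_gt0 vN hw.
rewrite /weight (count31_2_child_peak v0 vN' hw) (count31_2_rev_child_peak v0 vN' hw).
rewrite (records_child_peak v0 vN' hw) (records_rev_child_peak v0 vN' hw).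
rewrite size_child_peak !exprD /=.
have -> : ((size (l ++ 0%N :: r))./2 = (size (l ++ 0%N :: r))./2.-1.+1)%N.
  move: (zeros_valid_gt1 vN hw); rewrite zeros_cat zeros_cons size_cat /=.
  by have := zeros_size l; have := zeros_size r; lia.
have E (y : A) a b : (0 < a)%N -> y ^+ (a + b).-1 = y ^+ a.-1 * y ^+ b.
  by case: a => // a _; rewrite addSn exprD.
rewrite !E // exprS /peak_step /=; ring.
Qed.

Lemma weight_child_valley N v l r : (0 < v < N)%N -> valid N v (l ++ 0%N :: r) ->
  (0 < zeros l)%N -> (0 < zeros r)%N ->
  weight (l ++ v :: r) = weight (l ++ 0%N :: r) * valley_step (zeros l) (zeros r).
Proof.
move=> /andP[v0 vN] hw zl zr; have vN' := ltnW vN.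
rewrite /weight (count31_2_child_valley v0 vN' hw) //.
rewrite (count31_2_rev_child_valley v0 vN' hw) //.
rewrite (records_child_valley vN' hw) // (records_rev_child_valley vN' hw) //.
rewrite !size_cat /= !exprD /valley_step zl zr /=; ring.
Qed.

Lemma sum_children N v w y : (0 < v < N)%N -> valid N v w ->
  \sum_(w' <- children v w | zeros w' == y) weight w' =
  weight w * ((y == (zeros w).+1)%:R * up_weight (zeros w).-2
              + (y.+1 == zeros w)%:R * down_weight (zeros w).-2).
Proof.
move=> hv hw; have [v0 vN] := andP hv.
have z2 := zeros_valid_gt1 vN hw.
have ez : zeros w = (zeros w).-2.+2 by lia.
have splitE lr : lr \in splits w -> w = lr.1 ++ 0%N :: lr.2 /\
    zeros lr.2 = ((zeros w).-2.+1 - zeros lr.1)%N.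
  rewrite mem_splits => /eqP e; split=> //.
  by have := congr1 zeros e; rewrite zeros_cat zeros_cons; lia.
rewrite /children big_cat !big_map big_filter_cond /= mulrDr; congr (_ + _).
  rewrite mulrCA /up_weight -ez -(sum_splits w (fun t => peak_step t ((zeros w).-2.+1 - t))).
  rewrite !mulr_sumr [LHS]big_mkcond big_seq [RHS]big_seq; apply: eq_bigr => lr /splitE[e ezr].
  have -> : zeros (lr.1 ++ [:: 0, v, 0 & lr.2]%N) = (zeros w).+1.
    rewrite zeros_cat !zeros_cons [in RHS]e zeros_cat zeros_cons; lia.
  rewrite [y == _]eq_sym; case: eqP => _; last by rewrite mul0r.
  by rewrite mul1r (weight_child_peak hv) -?e // ezr.
rewrite mulrCA /down_weight -ez -(sum_splits w (fun t => valley_step t ((zeros w).-2.+1 - t))).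
rewrite !mulr_sumr [LHS]big_mkcond big_seq [RHS]big_seq; apply: eq_bigr => lr /splitE[e ezr].
have -> : zeros (lr.1 ++ v :: lr.2) = (zeros w).-1.
  rewrite zeros_cat !zeros_cons [in RHS]e zeros_cat zeros_cons; lia.
rewrite -ezr andbC (_ : ((zeros w).-1 == y) = (y.+1 == zeros w)); last by lia.
case: eqP => _; last by rewrite mul0r.
rewrite mul1r /=; case: ifP => [/andP[zl zr]|zz].
  by rewrite (weight_child_valley hv) -?e.
by rewrite /valley_step zz mulr0.
Qed.

(** The walk starts after the insertion of [N], which is the only letter with no
    larger letter on either side; what it adds to the statistics is what the
    decrements in the exponents of [weight] take away. *)
Theorem sum_words N k j : (k < N)%N ->
  \sum_(w <- words N k.+1 | zeros w == j.+2) weight w =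
  walk up_weight down_weight k j.
Proof.
elim: k j => [|k IH] j kN.
  case: N kN => // N' _; rewrite /= big_cons big_nil subn0 /= /zeros /=.
  case: j => [|j]; rewrite /= ?addr0 // /weight /=.
  by rewrite !ltnn !expr0 !mulr1.
rewrite [words _ _]/= big_flatten big_map /=.
have {}IH := fun j => IH j (ltnW kN).
have hv : (0 < N - k.+1 < N)%N by lia.
transitivity (\sum_(w <- words N k.+1) weight w *
    ((j.+2 == (zeros w).+1)%:R * up_weight (zeros w).-2
              + (j.+3 == zeros w)%:R * down_weight (zeros w).-2)).
  rewrite [LHS]big_seq [RHS]big_seq; apply: eq_bigr => w.
  by rewrite (mem_words _ (ltnW kN)) => /(sum_children _ hv) ->.
under eq_bigr do rewrite mulrDr.
rewrite big_split /=; congr (_ + _).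
  case: j => [|j].
    rewrite big_seq big1 // => w; rewrite (mem_words _ (ltnW kN)) => hw.
    have := zeros_valid_gt1 _ hw; have -> : (2 == (zeros w).+1)%N = (zeros w == 1)%N by lia.
    by case: eqP => [->|_ _]; [lia | rewrite mul0r mulr0].
  rewrite -IH mulr_sumr [RHS]big_mkcond; apply: eq_bigr => w _ /=.
  have -> : (j.+3 == (zeros w).+1)%N = (zeros w == j.+2)%N by lia.
  by case: eqP => [->|_]; rewrite ?mul0r ?mulr0 // mul1r mulrC.
rewrite -IH mulr_sumr [RHS]big_mkcond; apply: eq_bigr => w _ /=.
rewrite eq_sym.
by case: eqP => [->|_]; rewrite ?mul0r ?mulr0 // mul1r mulrC.
Qed.

End Weights.

(** * Permutations as words *)
Section StatisticsByPositions.
Local Open Scope nat_scope.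
Implicit Types (w : seq nat).

Lemma count31_2_sum w : count31_2 w = \sum_(0 <= i < size w) \sum_(0 <= j < size w)
  [&& i < j, nth 0 w j < nth 0 w i & nth 0 w i.+1 < nth 0 w j].
Proof.
elim: w => [|x w IH]; first by rewrite big_geq.
rewrite [size _]/= big_nat_recl // [in RHS]big_nat_recl //= add0n; congr (_ + _).
  case: w {IH} => [|y w]; first by rewrite big_geq.
  rewrite -sum1_count big_mkcond (big_nth 0); apply: eq_bigr => i _ /=.
  by rewrite andbC; case: ifP.
by rewrite IH; apply: eq_bigr => i _; rewrite [RHS]big_nat_recl //= add0n.
Qed.

Lemma records_sum m w : records m w = \sum_(0 <= i < size w)
  ((m < nth 0 w i) && all (fun j => nth 0 w j < nth 0 w i) (iota 0 i)).
Proof.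
elim: w m => [|x w IH] m; first by rewrite big_geq.
rewrite [size _]/= big_nat_recl //= andbT IH; congr (_ + _).
apply: eq_bigr => i _; rewrite (iotaDl 1 0) all_map /= gtn_max andbA.
by congr (nat_of_bool (_ && _)); apply: eq_all.
Qed.

Lemma altsum_sum w :
  altsum w = (\sum_(0 <= i < size w) (-1) ^+ i * (nth 0%N w i)%:Z)%R.
Proof.
elim: w => [|x w IH]; first by rewrite big_geq.
rewrite [size _]/= big_nat_recl //= IH expr0 mul1r; congr (_ + _)%R.
by rewrite -sumrN; apply: eq_bigr => i _; rewrite exprS mulN1r mulNr.
Qed.

Lemma zigzagP b w : reflect
  (forall i, i.+1 < size w -> if b (+) odd i then nth 0 w i < nth 0 w i.+1
                              else nth 0 w i.+1 < nth 0 w i)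
  (zigzag b w).
Proof.
elim: w b => [|x [|y w] IH] b; try by apply: (iffP idP).
apply: (iffP andP) => [[h /IH h'] [_|i hi]|h].
- by rewrite addbF.
- by have := h' i hi; rewrite /= addbN addNb.
split; first by have := h 0 isT; rewrite addbF.
by apply/IH => i hi; have := h i.+1 hi; rewrite /= addbN addNb.
Qed.

End StatisticsByPositions.

Section PermutationWord.
Local Open Scope nat_scope.
Variables (N : nat).
Implicit Types (s : 'S_N) (i : nat).

Definition perm_word s := [seq letter s i | i <- iota 0 N.+2].

Lemma mem_positions i : (i \in positions N) = (0 < i <= N).
Proof. by rewrite mem_iota add1n ltnS. Qed.

Lemma letter0 s : letter s 0 = 0. Proof. by []. Qed.

Lemma letter_ord s (i : 'I_N) : letter s i.+1 = (s i).+1.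
Proof. by rewrite /letter insubT ?ltn_ord // => h; congr (s _).+1; apply: val_inj. Qed.

Lemma letter_out s i : N < i -> letter s i = 0.
Proof. by case: i => // i h; rewrite /letter insubF // ltnNge -ltnS h. Qed.

Lemma letter_gt0 s i : 0 < i <= N -> 0 < letter s i.
Proof. by case: i => // i /= h; rewrite (letter_ord s (Ordinal h)). Qed.

Lemma letter_inj s : {in positions N &, injective (letter s)}.
Proof.
move=> [|i] [|j]; rewrite !mem_iota // add1n !ltnS => hi hj.
rewrite (letter_ord s (Ordinal hi)) (letter_ord s (Ordinal hj)) => -[] /val_inj.
by move=> /perm_inj [->].
Qed.

Lemma size_perm_word s : size (perm_word s) = N.+2.
Proof. by rewrite size_map size_iota. Qed.

Lemma nth_perm_word s i : nth 0 (perm_word s) i = letter s i.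
Proof.
case: (ltnP i N.+2) => h; first by rewrite (nth_map 0) ?size_iota // nth_iota.
by rewrite nth_default ?size_perm_word // letter_out // ltnW.
Qed.

Lemma perm_wordE s : perm_word s = 0 :: rcons [seq letter s i | i <- positions N] 0.
Proof.
rewrite /perm_word -addn1 iotaD map_cat /= -cats1 /positions.
by rewrite (letter_out s (ltnSn N)).
Qed.

Lemma perm_eq_letters s : perm_eq [seq letter s i | i <- positions N] (iota 1 N).
Proof.
apply: uniq_perm; rewrite ?iota_uniq //.
  by rewrite map_inj_in_uniq ?iota_uniq //; apply: letter_inj.
apply: (uniq_min_size _ _ _).2.
- by rewrite map_inj_in_uniq ?iota_uniq //; apply: letter_inj.
- move=> c /mapP[i]; rewrite mem_positions => + ->; case: i => [|i] hi; first by lia.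
  have {}hi : i < N by lia.
  by rewrite (letter_ord s (Ordinal hi)) mem_iota /= add1n ltnS ltn_ord.
- by rewrite size_map !size_iota.
Qed.

Lemma perm_word_inj : injective perm_word.
Proof.
move=> s t e; apply/permP => i; apply/val_inj/succn_inj.
by rewrite -!letter_ord -!nth_perm_word e.
Qed.

Lemma zeros_perm_word s : zeros (perm_word s) = 2.
Proof.
rewrite perm_wordE -cats1 zeros_cons zeros_cat /zeros.
by rewrite (seq.permP (perm_eq_letters s)) count_uniq_mem ?iota_uniq // mem_iota.
Qed.

Lemma valid_perm_word s : odd N -> valid N 0 (perm_word s) = alternating s.
Proof.
move=> oN; rewrite /valid subn0.
have -> : perm_eq [seq c <- perm_word s | 0 < c] (iota 1 N).
  have /all_filterP e : all (fun c => 0 < c) [seq letter s i | i <- positions N].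
    by apply/allP => c; rewrite (perm_mem (perm_eq_letters s)) mem_iota; case: c.
  by rewrite perm_wordE -cats1 /= filter_cat cats0 e perm_eq_letters.
have hd : head 1 (perm_word s) = 0 by rewrite perm_wordE.
have la : last 1 (perm_word s) = 0 by rewrite perm_wordE /= last_rcons.
rewrite hd la !eqxx andbT !andTb.
apply/zigzagP/allP => [h i|h [_|i]].
- rewrite mem_iota => hi; have := h i; rewrite !nth_perm_word size_perm_word.
  by move=> /(_ ltac:(lia)); case: odd.
- by rewrite !nth_perm_word letter_gt0 //; case: (N) oN.
rewrite !nth_perm_word size_perm_word => hi.
have [iN|iN] := ltnP i.+1 N.
  by have := h i.+1; rewrite mem_iota => /(_ ltac:(lia)); case: odd.
have -> : i.+1 = N by lia.
by rewrite oN (letter_out s (ltnSn N)) letter_gt0 //; case: (N) oN => //= k _.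
Qed.

(** With two zeros only, the letters between them form a rearrangement of [1..N]. *)
Lemma perm_word_surj w : valid N 0 w -> zeros w = 2 -> exists s, perm_word s = w.
Proof.
move=> /and4P[hd la _]; rewrite subn0.
case: w hd la => [//|x w] /= /eqP->; case/lastP: w => [//|m y].
rewrite last_rcons => /eqP->; rewrite -cats1 filter_cat cats0 => pm.
rewrite zeros_cons zeros_cat /= addn1 => -[] z0.
have {z0} nz : all (ltn 0) m.
  apply/allP => c cm; rewrite /= lt0n; apply: contraTneq cm => ->.
  by apply/count_memPn; case: z0.
move: pm; rewrite (all_filterP nz) => pm.
have /tuple_permP[p e] : perm_eq m (iota_tuple N 1) by [].
exists p; rewrite perm_wordE -cats1; congr (_ :: _ ++ _).
apply: (@eq_from_nth _ 0); first by rewrite size_map size_iota (perm_size pm) size_iota.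
move=> i; rewrite size_map size_iota => iN.
rewrite (nth_map 0) ?size_iota // nth_iota // (letter_ord p (Ordinal iN)) e.
rewrite (nth_map (Ordinal iN)) ?size_enum_ord // (tnth_nth 0) nth_iota //.
by rewrite add1n; congr (nat_of_ord (p _)).+1; apply: val_inj; rewrite /= nth_enum_ord.
Qed.

Lemma nmod_sum_positions (V : nmodType) (F : nat -> V) :
  F 0 = 0%R -> F N.+1 = 0%R ->
  (\sum_(i <- positions N) F i = \sum_(0 <= i < N.+2) F i)%R.
Proof.
move=> F0 FN; rewrite big_nat_recr //= FN addr0 big_ltn // F0 add0r.
by rewrite /index_iota subn1.
Qed.

Lemma sum_positions (F : nat -> nat) : F 0 = 0 -> F N.+1 = 0 ->
  \sum_(i <- positions N) F i = \sum_(0 <= i < N.+2) F i.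
Proof. exact: nmod_sum_positions. Qed.

Lemma count_sum (T : Type) (P : pred T) (t : seq T) : count P t = \sum_(c <- t) P c.
Proof. by rewrite -sum1_count big_mkcond; apply: eq_bigr => c _; case: ifP. Qed.

Lemma pat31_2_word s : pat31_2 s = count31_2 (perm_word s).
Proof.
rewrite /pat31_2 count_sum big_allpairs [LHS]/= count31_2_sum size_perm_word.
rewrite sum_positions; first last.
- by rewrite big1_seq // => j; rewrite mem_iota; lia.
- by rewrite big1 // => j _; rewrite letter0 ltn0 andbF.
apply: eq_bigr => i _; rewrite sum_positions; first last.
- by rewrite (letter_out s (ltnSn N)) ltn0 !andbF.
- by rewrite ltn0.
by apply: eq_bigr => j _; rewrite !nth_perm_word.
Qed.

(** Reading a word backwards turns the pattern 2-13 into 31-2. *)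
Lemma pat2_13_word s : pat2_13 s = count31_2 (rev (perm_word s)).
Proof.
rewrite /pat2_13 count_sum big_allpairs exchange_big [LHS]/=.
rewrite count31_2_sum size_rev size_perm_word big_nat_rev big_nat_recl //.
rewrite [X in _ = X + _]big1_seq ?add0n; last first.
  by move=> j; rewrite mem_index_iota; lia.
rewrite sum_positions; first last.
- by rewrite big1 // => j _; rewrite [N.+1 < N]ltnNge leqnSn andbF.
- by rewrite big1 // => j _; rewrite ltn0.
rewrite big_nat_recr //= [X in _ + X]big1 ?addn0; last first.
  by move=> j _; rewrite [N.+1 < N]ltnNge leqnSn andbF.
apply: eq_big_nat => b hb; rewrite [RHS]big_nat_rev /= add0n.
rewrite sum_positions; first last.
- by rewrite (letter_out s (ltnSn N)) ltn0 !andbF.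
- by rewrite letter0 ltn0 !andbF.
apply: eq_big_nat => a ha.
rewrite !nth_rev ?size_perm_word; try lia.
have -> : N.+2 - (N.+2 - a.+1).+1 = a by lia.
have -> : N.+2 - (0 + N.+2 - b.+2).+1 = b.+1 by lia.
have -> : N.+2 - (0 + N.+2 - b.+2).+2 = b by lia.
rewrite !nth_perm_word.
have [eN|nN] := eqVneq b N; first by rewrite eN (letter_out s (ltnSn N)) !ltn0 !andbF.
have [->|nab] := eqVneq a b; first by lia.
lia.
Qed.

Lemma lmax_word s : lmax s = records 0 (perm_word s).
Proof.
rewrite records_sum size_perm_word /lmax count_sum -sum_positions; first last.
- by rewrite nth_perm_word (letter_out s (ltnSn N)).
- by rewrite nth_perm_word letter0.
apply: eq_big_seq => i; rewrite mem_iota => hi; congr nat_of_bool.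
rewrite nth_perm_word letter_gt0 /=; last by lia.
apply/allP/allP => h j; rewrite mem_iota => hj.
  rewrite nth_perm_word; case: j hj => [|j] hj; first by rewrite letter_gt0; lia.
  by have := h j.+1; rewrite mem_iota => /(_ ltac:(lia))/implyP; apply; lia.
apply/implyP => ji; have := h j; rewrite mem_iota nth_perm_word; apply; lia.
Qed.

Lemma rmax_word s : rmax s = records 0 (rev (perm_word s)).
Proof.
rewrite records_sum size_rev size_perm_word big_nat_rev /= add0n /rmax count_sum.
rewrite -sum_positions; first last.
- rewrite nth_rev size_perm_word ?nth_perm_word; last by lia.
  by rewrite letter_out; lia.
- rewrite nth_rev size_perm_word ?nth_perm_word; last by lia.
  by rewrite (_ : N.+2 - (N.+2 - 1).+1 = 0) ?letter0 //; lia.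
apply: eq_big_seq => i; rewrite mem_iota => hi; congr nat_of_bool.
have e : N.+2 - (N.+2 - i.+1).+1 = i by lia.
rewrite nth_rev size_perm_word ?e ?nth_perm_word; last by lia.
rewrite letter_gt0 /=; last by lia.
apply/allP/allP => h j; rewrite mem_iota => hj.
  rewrite nth_rev size_perm_word ?nth_perm_word; last by lia.
  have [jN|jN] := leqP (N.+2 - j.+1) N; last by rewrite letter_out ?letter_gt0; lia.
  by have := h (N.+2 - j.+1); rewrite mem_iota => /(_ ltac:(lia))/implyP; apply; lia.
apply/implyP => ji; have := h (N.+2 - j.+1).
rewrite mem_iota nth_rev size_perm_word ?nth_perm_word; last by lia.
by rewrite (_ : N.+2 - (N.+2 - j.+1).+1 = j); last lia; apply; lia.
Qed.

(** * Statistics of alternating permutations *)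
Section Alternating.
Variable s : 'S_N.
Hypotheses (N_odd : odd N) (s_alt : alternating s).

Let s_zigzag i : i <= N ->
  if odd i then letter s i.+1 < letter s i else letter s i < letter s i.+1.
Proof.
move=> iN; have : valid N 0 (perm_word s) by rewrite valid_perm_word.
case/and4P => _ _ /zigzagP/(_ i); rewrite size_perm_word !nth_perm_word ltnS => /(_ iN).
by case: odd.
Qed.

Lemma peak_at_odd i : 0 < i <= N -> peak_at s i = odd i.
Proof.
case: i => // i hi; have := s_zigzag hi; have := s_zigzag (ltnW hi).
by rewrite /peak_at /=; case: odd; rewrite /=; lia.
Qed.

Lemma valley_at_even i : 0 < i <= N -> valley_at s i = ~~ odd i.
Proof.
case: i => // i hi; have := s_zigzag hi; have := s_zigzag (ltnW hi).
by rewrite /valley_at /=; case: odd; rewrite /=; lia.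
Qed.

(** A valley has a larger letter on each side, so it is not a maximum of either kind. *)
Lemma lmaxpk_alternating : lmaxpk s = lmax s.
Proof.
apply: eq_in_count => i; rewrite mem_iota => hi; rewrite peak_at_odd; last by lia.
case: (boolP (lmax_at s i)) => //= /allP h; apply/negPn/negP => ev.
case: i hi ev h => // i hi ev /(_ i); rewrite mem_iota => /(_ ltac:(lia)).
have := s_zigzag (i := i) ltac:(lia); rewrite /= negbK in ev *.
by rewrite ev leqnn /=; lia.
Qed.

Lemma rmaxpk_alternating : rmaxpk s = rmax s.
Proof.
apply: eq_in_count => i; rewrite mem_iota => hi; rewrite peak_at_odd; last by lia.
case: (boolP (rmax_at s i)) => //= /allP h; apply/negPn/negP => ev.
have := h i.+1; rewrite mem_iota => /(_ ltac:(lia)).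
by have := s_zigzag (i := i) ltac:(lia); rewrite (negbTE ev) leqnn /=; lia.
Qed.

Lemma des_alternating : des s = N./2.
Proof.
rewrite /des (eq_in_count (a2 := odd)).
  have -> : N.-1 = N./2.*2 by lia.
  by elim: (N./2) => // k IH; rewrite doubleS -addn2 iotaD count_cat IH /=; lia.
move=> i; rewrite mem_iota => hi; have := s_zigzag (i := i) ltac:(lia).
by case: odd; lia.
Qed.

(** The letter [N] is a peak, so leaving it out of the sum over peaks subtracts [N]. *)
Lemma Dstat_altsum : Dstat s = (- altsum (perm_word s) - N%:Z)%R.
Proof.
have [i hi [li lj]] := letter_max s ltac:(lia).
have uP : uniq (Pk s).
  rewrite map_inj_in_uniq ?filter_uniq ?iota_uniq // => a b.
  by rewrite !mem_filter => /andP[_ ha] /andP[_ hb]; apply: letter_inj.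
have NP : N \in Pk s.
  apply/mapP; exists i; last by rewrite li.
  rewrite mem_filter mem_positions peak_at_odd // hi andbT.
  apply/negPn/negP => ev; have := s_zigzag (i := i) ltac:(lia).
  by rewrite (negbTE ev) li; have := lj i.+1 ltac:(lia); lia.
have eP : (\sum_(v <- Pk s) v = N + \sum_(v <- Pk s | v != N) v)%N.
  exact: (bigD1_seq N (F := fun v => v) NP uP).
rewrite /Dstat.
have -> : (\sum_(v <- Pk s | v != N) v = \sum_(v <- Pk s) v - N)%N.
  by rewrite eP addKn.
rewrite altsum_sum size_perm_word -nmod_sum_positions; first last.
- by rewrite nth_perm_word (letter_out s (ltnSn N)) mulr0.
- by rewrite nth_perm_word letter0 mulr0.
rewrite -subzn; last by rewrite eP leq_addr.
rewrite addrAC; congr (_ - _)%R; rewrite /Pk /Val !big_map !big_filter.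
rewrite !(big_morph Posz PoszD (erefl 0%Z)).
rewrite big_mkcond [X in (_ - X)%R]big_mkcond -sumrB -sumrN.
apply: eq_big_seq => a; rewrite mem_positions => ha.
rewrite peak_at_odd // valley_at_even // nth_perm_word -signr_odd.
by case: odd; rewrite /= ?expr0 ?expr1; ring.
Qed.

End Alternating.
End PermutationWord.

(** Lowering the threshold [v = N - k] by one adds to (sum of peaks - sum of
    valleys - [v] * number of blocks) the new number of blocks, while the two
    pattern counts together grow by one less than this number.  So the
    difference between the two quantities is the number [k] of inserted
    letters. *)
Lemma altsum_words N k w : (k <= N)%N -> w \in words N k ->
  altsum w = - (count31_2 w + count31_2 (rev w) + (N - k) * (zeros w).-1 + k)%N%:Z.
Proof.
elim: k w => [|k IH] w kN.
  by rewrite inE => /eqP -> /=; rewrite muln0.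
case/flatten_mapP => w0 hw0; have kN' := ltnW kN.
have e0 := IH _ kN' hw0; move: hw0; rewrite (mem_words _ kN') => hw.
have v0 : (0 < N - k)%N by lia.
have vN : (N - k <= N)%N by lia.
have [m em] : exists m, (N - k = m.+1)%N by exists (N - k).-1; lia.
have em' : (N - k.+1 = m)%N by lia.
rewrite mem_cat => /orP[] /mapP[[l r] /=].
  rewrite mem_splits /= => /eqP e; subst w0 => ->.
  rewrite (altsum_child_peak hw) e0 (count31_2_child_peak v0 vN hw).
  rewrite (count31_2_rev_child_peak v0 vN hw) em' em !zeros_cat !zeros_cons /=.
  by move: (zeros l) (zeros r) => a b; rewrite !addnS /=; lia.
rewrite mem_filter mem_splits /= => /andP[/andP[zl zr] /eqP e]; subst w0 => ->.
rewrite (altsum_child_valley hw) // e0 (count31_2_child_valley v0 vN hw) //.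
rewrite (count31_2_rev_child_valley v0 vN hw) // em' em !zeros_cat !zeros_cons.
move: (zeros l) (zeros r) zl zr => [|a] [|b] // _ _.
have -> : ((a.+1 + ((0 == 0) + b.+1)).-1 = a + b + 2)%N by lia.
have -> : ((a.+1 + ((m.+1 == 0) + b.+1)).-1 = a + b + 1)%N by lia.
have -> : (m.+1 * (a + b + 2) = m * (a + b + 1) + (a + b + 2) + m)%N by ring.
by rewrite ![_.+1.-1]/=; move: (m * _)%N (count31_2 _) (count31_2 _) => M P Q; lia.
Qed.

Lemma Zo_walk (A : comNzRingType) (x f g h alpha beta p q : A) (n : nat) :
  Zo x f g h alpha beta p q n =
  walk (up_weight x f g h alpha beta p q) (down_weight h p q) (2 * n) 0.
Proof.
pose N := (2 * n).+1; have oN : odd N by rewrite /N /= oddM.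
rewrite -(@sum_words _ x f g h alpha beta p q N) //.
have memE w : (w \in words N N) = valid N 0 w by rewrite mem_words // subnn.
transitivity (\sum_(w <- [seq perm_word s | s <- enum [pred s : 'S_N | alternating s]])
    weight x f g h alpha beta p q w).
  rewrite big_map big_enum /=; apply: eq_bigr => s alt_s.
  have ew : perm_word s \in words N N by rewrite memE valid_perm_word.
  have eD : (`|Dstat s| = count31_2 (perm_word s) + count31_2 (rev (perm_word s)))%N.
    rewrite Dstat_altsum // (altsum_words _ ew) // subnn mul0n addn0.
    by rewrite opprK PoszD addrK absz_nat.
  rewrite /weight lmaxpk_alternating // rmaxpk_alternating // des_alternating // eD.
  rewrite pat31_2_word pat2_13_word lmax_word rmax_word size_perm_word.
  by rewrite -[X in x ^+ X.-1]/(N./2.+1) !exprMn exprD; ring.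
rewrite -[RHS]big_filter; apply: perm_big; apply: uniq_perm.
- by rewrite map_inj_uniq ?enum_uniq //; apply: perm_word_inj.
- by rewrite filter_uniq // uniq_words.
move=> w; rewrite mem_filter memE; apply/mapP/andP => [[s]|[/eqP zw hw]].
  by rewrite mem_enum inE => alt_s ->; rewrite zeros_perm_word valid_perm_word.
have [s es] := perm_word_surj hw zw; exists s => //.
by rewrite mem_enum inE -valid_perm_word // es.
Qed.

(** * Polynomials with nonnegative coefficients *)
Section NonnegativeCoefficients.
Variables (R : realType) (m : nat).
Local Notation nonneg := (@coef_nonneg R m).

Lemma coef_nonneg_nat k : nonneg k%:R.
Proof. by move=> mon; rewrite mcoeffMn mulrn_wge0 // mcoeff1 ler0n. Qed.

Lemma coef_nonnegX i : nonneg 'X_i.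
Proof. by move=> mon; rewrite mcoeffX ler0n. Qed.

Lemma coef_nonnegD P Q : nonneg P -> nonneg Q -> nonneg (P + Q).
Proof. by move=> hP hQ mon; rewrite mcoeffD addr_ge0. Qed.

Lemma coef_nonnegM P Q : nonneg P -> nonneg Q -> nonneg (P * Q).
Proof.
by move=> hP hQ mon; rewrite mcoeffM sumr_ge0 // => k _; apply: mulr_ge0.
Qed.

Lemma coef_nonneg_exp P k : nonneg P -> nonneg (P ^+ k).
Proof.
move=> hP; elim: k => [|k IH]; first exact: (coef_nonneg_nat 1).
by rewrite exprS; apply: coef_nonnegM.
Qed.

Lemma coef_nonneg_sum (I : Type) (t : seq I) (F : I -> {mpoly R[m]}) :
  (forall i, nonneg (F i)) -> nonneg (\sum_(i <- t) F i).
Proof.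
by move=> hF; elim/big_ind: _ => //; [apply: (coef_nonneg_nat 0) | apply: coef_nonnegD].
Qed.

End NonnegativeCoefficients.

Theorem theorem7p2 (R : realType) : coefficientwise_Hankel_TP (Zo_poly R).
Proof.
move=> k r c hr hc; rewrite /Zo_poly.
under eq_mx do rewrite Zo_walk.
apply: (@walk_Hankel_TP _ (@coef_nonneg R 8)) => //.
- exact: (@coef_nonneg_nat R 8 0).
- exact: (@coef_nonneg_nat R 8 1).
- exact: coef_nonnegD.
- exact: coef_nonnegM.
- move=> j; apply: coef_nonneg_sum => t.
  by rewrite /peak_step; do ?apply: coef_nonnegM; do ?apply: coef_nonneg_exp;
    do ?apply: coef_nonnegM; apply: coef_nonnegX.
- move=> j; apply: coef_nonneg_sum => t.
  rewrite /valley_step; case: ifP => _; last exact: (@coef_nonneg_nat R 8 0).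
  by do ?apply: coef_nonnegM; do ?apply: coef_nonneg_exp;
    do ?apply: coef_nonnegM; apply: coef_nonnegX.
Qed.
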